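(* Let $(X,d_X)$ be a complete geodesic Gromov $\delta$-hyperbolic metric space ($\delta\ge0$), let $(Y,d_Y)$ be a compact geodesic metric space, let $x_0\in X$, $y_0\in Y$ be fixed, let $\alpha>0$, and let $\varphi:[0,\infty)\to[1,\infty)$ be of class $C^1$ with $\varphi'\ge\alpha\varphi$ and $\varphi'$ strictly increasing. Let $Z=X\times_\varphi Y$ and $\delta_\varphi=\frac1\alpha+44\delta+\frac32\varphi(0)\operatorname{diam}(Y)$. Then there exists a bijection $\Phi=(\Phi_1,\Phi_2):\partial_GZ\to\partial_GX\times Y$ such that for all $0<\varepsilon\le \log_e(2)/\delta_\varphi$, the map $\Phi$ is a homeomorphism between $(\partial_GZ,d_{\varepsilon,Z})$ and $(\partial_GX\times Y,\,d_{\varepsilon,X}\times d_Y)$ (product metric/topology), and for all $z,\widetilde z\in\partial_GZ$, $$d_{\varepsilon,Z}(z,\widetilde z)\simeq d_{\varepsilon,X}(\Phi_1(z),\Phi_1(\widetilde z))+\exp\left\{-\varepsilon\,\overline{\varphi^{-1}}\left(\frac{2}{\alpha\, d_Y(\Phi_2(z),\Phi_2(\widetilde z))}\right)\right\},$$ where the comparison constant depends only on $\alpha$, $\delta$, $\operatorname{diam}(Y)$, $\varphi(0)$, and the quantity $\overline{\varphi^{-1}}(\varphi'(0)/\alpha)$.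
   Context: $F\simeq H$ means $C^{-1}F\le H\le CF$ for a constant $C\ge1$ (the comparison constant). Gromov product: in a metric space $(M,d)$ with base point $w$, $(x|y)_w:=\frac12[d(x,w)+d(y,w)-d(x,y)]$. $(M,d)$ is Gromov $\delta$-hyperbolic if $(x|y)_w+\delta\ge\min\{(x|z)_w,(y|z)_w\}$ for all $x,y,z,w\in M$. A metric space is geodesic if every two points are joined by a curve whose length equals their distance. Warped metric: a curve is absolutely continuous if it is rectifiable and its length function $s$ is absolutely continuous; $|\gamma'(t)|:=s'(t)$. For a curve $\gamma=(\gamma_X,\gamma_Y):[a,b]\to X\times Y$ with $\gamma_X,\gamma_Y$ absolutely continuous, $\ell_\varphi(\gamma):=\ell_{d_X}(\gamma_X)+\int_a^b\varphi(d_X(\gamma_X(t),x_0))|\gamma_Y'(t)|\,dt$; $d_\varphi(z,w)$ is the infimum of $\ell_\varphi(\gamma)$ over all such curves from $z$ to $w$; $X\times_\varphi Y:=(X\times Y,d_\varphi)$. $\overline{\varphi^{-1}}:[0,\infty]\to[0,\infty]$ is the zero extension of the inverse of $\varphi$: $\overline{\varphi^{-1}}(t)=0$ for $0\le t<\varphi(0)$, $\overline{\varphi^{-1}}(t)=\varphi^{-1}(t)$ for $\varphi(0)\le t<\infty$, $\overline{\varphi^{-1}}(\infty)=\infty$. Conventions: $2/0=\infty$, $e^{-\infty}=0$. Gromov boundary: for a Gromov hyperbolic space $M$ with base point $w_0$, a sequence $(x_i)$ is a Gromov sequence if $\lim_{i,j\to\infty}(x_i|x_j)_{w_0}=\infty$;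 two Gromov sequences are equivalent if $\lim_i(x_i|y_i)_{w_0}=\infty$; $\partial_GM$ is the set of equivalence classes. For $\overline x,\overline y\in\partial_GM$, $(\overline x|\overline y)_{w_0}:=\inf\{\liminf_{i,j\to\infty}(x_i|y_j)_{w_0}:(x_i)\in\overline x,(y_j)\in\overline y\}$. For $\varepsilon>0$, $$d_{\varepsilon,M}(\overline x,\overline y):=\inf\Big\{\sum_{i=1}^k e^{-\varepsilon(\overline x_{i-1}|\overline x_i)_{w_0}}: k\in\mathbb N,\ \overline x_0,\dots,\overline x_k\in\partial_GM,\ \overline x_0=\overline x,\ \overline x_k=\overline y\Big\}.$$ The base point is $x_0$ for $M=X$ and $z_0=(x_0,y_0)$ for $M=Z$. *)

(* Defs.v *)
From HB Require Import structures.
From mathcomp Require Import all_boot all_order all_algebra.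
From mathcomp Require Import all_classical all_reals all_analysis.

Set Implicit Arguments.
Unset Strict Implicit.
Unset Printing Implicit Defensive.

Import Order.TTheory GRing.Theory Num.Theory.
Import numFieldNormedType.Exports.

Local Open Scope classical_set_scope.
Local Open Scope ring_scope.

Definition comparable_with (R : realType) (C F H : R) : Prop :=
  C^-1 * F <= H <= C * F.

(** [dist_space d] is the carrier of [d] with the topology whose open sets are
    those containing a [d]-ball around each of their points.  No axiom on [d]
    is needed to get a topology; when [d] is a metric it is the metric one. *)

Definition dist_space (R : realType) (T : Type) (d : T -> T -> R) : Type := T.

Section dist_topology.
Context (R : realType) (T : Type) (d : T -> T -> R).

Definition dist_open : set_system (dist_space d) :=
  [set A | forall x, A x ->
     exists2 e : R, 0 < e & [set y : T | d x y < e] `<=` A].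

Let dist_openT : dist_open setT.
Proof. by move=> x _; exists 1. Qed.

Let dist_openI : setI_closed dist_open.
Proof.
move=> A B oA oB x [/oA[e e0 eA] /oB[f f0 fB]].
exists (Num.min e f); first by rewrite lt_min e0.
by move=> y /=; rewrite lt_min => /andP[/eA ? /fB].
Qed.

Let dist_open_bigU (I : Type) (f : I -> set (dist_space d)) :
  (forall i, dist_open (f i)) -> dist_open (\bigcup_i f i).
Proof.
move=> fo x [i _ /fo[e e0 ef]]; exists e => // y /ef fiy.
by exists i.
Qed.

HB.instance Definition _ := gen_eqMixin (dist_space d).
HB.instance Definition _ := gen_choiceMixin (dist_space d).
HB.instance Definition _ := isOpenTopological.Build (dist_space d)
  dist_openT dist_openI dist_open_bigU.

End dist_topology.

Definition homeomorphism (T U : topologicalType) (f : T -> U) : Prop :=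
  continuous f /\
  exists g : U -> T, [/\ cancel f g, cancel g f & continuous g].

(** What follows is stated for a bare distance function [d], so as to apply
    both to a [metricType] and to the warped product. *)

Section gromov.
Context (R : realType) (T : Type) (d : T -> T -> R).

Definition gromov_prod (w x y : T) : R := (d x w + d y w - d x y) / 2.

Definition gromov_hyperbolic (delta : R) : Prop :=
  forall x y z w : T,
    Num.min (gromov_prod w x z) (gromov_prod w y z) <=
      gromov_prod w x y + delta.

Context (w : T).

Definition gromov_seq (x : nat -> T) : Prop :=
  gromov_prod w (x ij.1) (x ij.2) @[ij --> filter_prod \oo \oo] --> +oo.

Definition gromov_equiv (x y : nat -> T) : Prop :=
  gromov_prod w (x i) (y i) @[i --> \oo] --> +oo.

(* For hyperbolic [d], [gromov_equiv] is an equivalence relation on Gromov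
   sequences and these are its equivalence classes. *)
Definition gromov_class (A : set (nat -> T)) : Prop :=
  exists2 x, gromov_seq x & A = [set y | gromov_seq y /\ gromov_equiv x y].

Definition gromov_boundary : Type := {A : set (nat -> T) | gromov_class A}.

Definition boundary_prod (a b : gromov_boundary) : \bar R :=
  ereal_inf
    [set limf_einf (fun ij : nat * nat =>
                      (gromov_prod w (x ij.1) (y ij.2))%:E)
           (filter_prod \oo \oo)
    | x in sval a & y in sval b].

(* [fine] is harmless here: the exponents are nonnegative, possibly [+oo],
   and [expeR -oo = 0]. *)
Definition expN (eps : R) (g : \bar R) : R := fine (expeR (- (eps%:E * g))%E).

Definition visual_dist (eps : R) (a b : gromov_boundary) : R :=
  inf [set r : R | exists (k : nat) (x : nat -> gromov_boundary),
    [/\ x 0%N = a, x k.+1 = b &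
        r = \sum_(i < k.+1) expN eps (boundary_prod (x i) (x i.+1))]].

Definition visual_boundary (eps : R) : topologicalType :=
  dist_space (visual_dist eps).

End gromov.

Section curves.
Context (R : realType) (M : metricType R).
Implicit Types (a b : R) (g : R -> M).

(* A curve [a, b] -> M is a function on [R] of which only the restriction to
   [a, b] is relevant. *)
Definition curve a b g : Prop := a <= b /\ {within `[a, b], continuous g}.

Definition curve_variation a g (s : seq R) : R :=
  let p := g \o nth a (a :: s) in
  \sum_(0 <= n < size s) mdist (p n) (p n.+1).

Definition curve_length a b g : \bar R :=
  ereal_sup [set (curve_variation a g s)%:E | s in itv_partition a b].

Definition length_fun a g (t : R) : R := fine (curve_length a t g).

(* At points where [length_fun] is not differentiable, a null set for a
   rectifiable curve, [derive1] has a junk value. *)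
Definition speed a g (t : R) : R := derive1 (length_fun a g) t.

End curves.

Definition abs_continuous (R : realType) (a b : R) (f : R -> R) : Prop :=
  forall e : R, 0 < e -> exists2 eta : R, 0 < eta &
    forall (n : nat) (I : 'I_n -> R * R),
      (forall i, a <= (I i).1 /\ (I i).1 <= (I i).2 /\ (I i).2 <= b) ->
      trivIset setT (fun i => `](I i).1, (I i).2[%classic) ->
      \sum_i ((I i).2 - (I i).1) < eta ->
      \sum_i `|f (I i).2 - f (I i).1| < e.

Definition ac_curve (R : realType) (M : metricType R) (a b : R) (g : R -> M) :
    Prop :=
  [/\ curve a b g, curve_length a b g \is a fin_num &
      abs_continuous a b (length_fun a g)].

Definition geodesic_space (R : realType) (M : metricType R) : Prop :=
  forall x y : M, exists (a b : R) (g : R -> M),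
    [/\ curve a b g, g a = x, g b = y & curve_length a b g = (mdist x y)%:E].

(* [completeType] requires a pointed type; this is its axiom for any metric
   space. *)
Definition complete_space (R : realType) (M : metricType R) : Prop :=
  forall F : set_system M, ProperFilter F -> cauchy F ->
    exists l : M, F --> l.

Definition diam (R : realType) (M : metricType R) : R :=
  sup [set r | exists x y : M, r = mdist x y].

Section warped.
Context (R : realType) (X Y : metricType R) (x0 : X) (phi : R -> R).

Definition warped_length (a b : R) (gX : R -> X) (gY : R -> Y) : \bar R :=
  (curve_length a b gX +
   \int[lebesgue_measure]_(t in `[a, b])
      (phi (mdist (gX t) x0) * speed a gY t)%:E)%E.

Definition warped_dist (z w : X * Y) : R :=
  fine (ereal_inf [set l | exists (a b : R) (gX : R -> X) (gY : R -> Y),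
    [/\ ac_curve a b gX, ac_curve a b gY,
        (gX a, gY a) = z, (gX b, gY b) = w & l = warped_length a b gX gY]]).

End warped.

(** A function on [0, +oo) is represented by a function on [R] whose values at
    negative arguments are irrelevant; the derivative at [0] is one-sided. *)

Definition C1_halfline (R : realType) (phi dphi : R -> R) : Prop :=
  (forall t : R, 0 <= t ->
     (phi s - phi t) / (s - t) @[s --> within `[0, +oo[ t^'] --> dphi t) /\
  {within `[0, +oo[, continuous dphi}.

(* The zero extension to [0, +oo] of the inverse of an increasing bijection
   [phi : [0, +oo) -> [phi 0, +oo)]; the value at [-oo] is irrelevant. *)
Definition phi_inv (R : realType) (phi : R -> R) (t : \bar R) : \bar R :=
  match t with
  | r%:E => if r < phi 0 then 0%E
            else (xget 0 [set s : R | 0 <= s /\ phi s = r])%:E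
  | +oo%E => +oo%E
  | -oo%E => 0%E
  end.

(* Main.v *)
Require Import Defs.
From HB Require Import structures.
From mathcomp Require Import all_boot all_order all_algebra.
From mathcomp Require Import all_classical all_reals all_analysis.
From mathcomp Require Import measurable_realfun ring lra zify.

(** Write [psi d] for [phi^-1 (2 / (alpha * d))].  Up to an additive constant
    [K] depending on [alpha], [delta], [phi 0] and [diam Y], the Gromov product
    of [(x, y)] and [(x', y')] in [Z] is the minimum of [(x|x')] and
    [psi (d (y, y'))].  Indeed, a curve whose [X]-component comes down to
    distance [m] from [x0] has length at least
    [d (x, x0) + d (x', x0) - 2 m + phi m * d (y, y')], and
    [phi m * d (y, y') >= 2 (m - psi (d (y, y')))] because [phi] grows at least
    like [exp (alpha t)]; conversely it is cheap enough to make the whole move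
    in [Y] over the point of the geodesic [x0, x] at that height.  So a sequence
    of [Z] converges to infinity iff its first component does and its second
    component converges, and the estimate passes to boundary products.  The
    visual metrics are infima over chains, and [exp (- eps * psi d)] is
    subadditive in [d] because [eps <= alpha], so the estimate also passes to
    the visual metrics; the hyperbolicity of [Z] itself is never needed.

    The lower bound on lengths rests on [s b - s a <= int_a^b s'] for an
    absolutely continuous length function [s]: the Stieltjes measure of [s] is
    dominated by Lebesgue measure, and by Lebesgue's differentiation theorem its
    Radon-Nikodym density is [s'] almost everywhere. *)

Set Implicit Arguments.
Unset Strict Implicit.
Unset Printing Implicit Defensive.

Import Order.TTheory GRing.Theory Num.Theory.
Import numFieldNormedType.Exports.

Local Open Scope classical_set_scope.
Local Open Scope ring_scope.

Local Notation mu := lebesgue_measure.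

(** * Integrating the derivative of an absolutely continuous function *)

(** Absolute continuity on the whole line, the form suited to a Stieltjes measure; a function on
    [a, b] is brought to it by [clamp]. *)
Definition ac_global (R : realType) (f : R -> R) : Prop :=
  forall e : R, 0 < e -> exists2 eta : R, 0 < eta &
    forall (n : nat) (I : 'I_n -> R * R),
      (forall i, (I i).1 <= (I i).2) ->
      trivIset setT (fun i => `](I i).1, (I i).2[%classic) ->
      \sum_i ((I i).2 - (I i).1) < eta ->
      \sum_i `|f (I i).2 - f (I i).1| < e.

(** Two points of [J] bound an interval inside [J], so the measure of [J] bounds their distance. The
    case [p = q] covers empty components of an open set. *)
Lemma open_interval_bounded_measure (R : realType) (J : set R) (eta : R) :
  open J -> is_interval J -> (lebesgue_measure J < eta%:E)%E ->
  exists p q : R, p <= q /\ J = `]p, q[%classic.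
Proof.
move=> oJ iJ Jeta.
have [->|/set0P[x0 Jx0]] := eqVneq J set0.
  by exists 0, 0; rewrite lexx; split=> //; rewrite set_itvoo0.
have mJ : measurable (J : set (measurableTypeR R)) by exact: open_measurable.
have Jlt x y : J x -> J y -> y - x < eta.
  move=> Jx Jy; have [xy|yx] := ltP x y; last first.
    rewrite (le_lt_trans (y := 0)) ?subr_le0// -lte_fin.
    by rewrite (le_lt_trans _ Jeta).
  rewrite -lte_fin (le_lt_trans _ Jeta)//.
  have -> : (y - x)%:E = lebesgue_measure (`[x, y]%classic : set R).
    by rewrite lebesgue_measure_itv/= lte_fin xy EFinB.
  apply: le_measure; rewrite ?inE//.
  by move=> z /=; rewrite in_itv/=; exact: iJ.
have lbJ : has_lbound J.
  exists (x0 - eta) => y Jy; have := Jlt _ _ Jy Jx0; lra.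
have ubJ : has_ubound J.
  exists (x0 + eta) => y Jy; have := Jlt _ _ Jx0 Jy; lra.
have JE : J = `]inf J, sup J[%classic.
  have := interval_bounded_interior iJ lbJ ubJ.
  by rewrite (interior_id _).1// => {1}->; rewrite set_itvoo.
exists (inf J), (sup J); split => //.
by move: Jx0; rewrite {1}JE/= in_itv/= => /andP[a b]; rewrite ltW// (lt_trans a b).
Qed.

Lemma lebesgue_stieltjes_itvoc (R : realType) (f : cumulative R R) (p q : R) :
  p <= q -> lebesgue_stieltjes_measure f `]p, q]%classic = (f q - f p)%:E.
Proof.
move=> pq; rewrite /lebesgue_stieltjes_measure /measure_extension.
rewrite measurable_mu_extE/=; last exact: is_ocitv.
by rewrite wlength_itv_bnd.
Qed.

(** A null set lies in an open set of Lebesgue measure below [eta]. The components of that set are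
    disjoint intervals, so absolute continuity bounds the Stieltjes measure of any finitely many of
    them by [e], and countable subadditivity that of their union. *)
Lemma ac_global_dominates (R : realType) (f : cumulative R R) :
  ac_global f -> lebesgue_stieltjes_measure f `<< (@lebesgue_measure R).
Proof.
move=> acf; apply/null_content_dominatesP => A mA A0.
apply/eqP; rewrite eq_le measure_ge0 andbT.
apply/lee_addgt0Pr => e e0; rewrite add0e.
have [eta eta0 Heta] := acf e e0.
have [|U [oU AU UA]] := lebesgue_regularity_outer mA _ eta0.
  by rewrite A0.
have mU : measurable (U : set (measurableTypeR R)) by exact: open_measurable.
have Ueta : (lebesgue_measure U < eta%:E)%E.
  rewrite (le_lt_trans _ UA)//.
  rewrite [leRHS](_ : _ = lebesgue_measure (U `\` A) + lebesgue_measure A)%E; last first.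
    by rewrite [X in _ = (_ + X)%E]A0 adde0.
  rewrite -[X in (lebesgue_measure X <= _)%E](setDUK AU) setUC.
  apply: measureU2 => //; exact: measurableD.
pose J := open_disjoint_itv oU.
have mJ k : measurable (J k : set (measurableTypeR R)).
  by apply: open_measurable; exact: open_disjoint_itv_open.
have UE : U = \bigcup_k J k by exact: open_disjoint_itv_bigcup.
have tJ : trivIset setT J by exact: open_disjoint_itv_trivIset.
have JU k : J k `<=` U by rewrite UE; exact: bigcup_sup.
have Jeta k : (lebesgue_measure (J k) < eta%:E)%E.
  by rewrite (le_lt_trans _ Ueta)// le_measure// inE.
have Jpq k : exists pq : R * R, pq.1 <= pq.2 /\ J k = `]pq.1, pq.2[%classic.
  have [||p [q [? ?]]] := @open_interval_bounded_measure _ (J k) eta _ _ (Jeta k).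
  - exact: open_disjoint_itv_open.
  - exact: open_disjoint_itv_is_interval.
  - by exists (p, q).
have [I HI] := choice Jpq.
rewrite (@le_trans _ _ (lebesgue_stieltjes_measure f U))//.
  by rewrite le_measure// inE.
rewrite {1}UE.
apply: (@le_trans _ _
  (\big[+%E/0%E]_(0 <= i <oo) lebesgue_stieltjes_measure f (J i))).
  by apply: generalized_Boole_inequality => //; exact: bigcup_measurable.
apply: lime_le.
  by apply: is_cvg_nneseries => n _ _; exact: measure_ge0.
apply: nearW => n.
apply: (@le_trans _ _ (\sum_(i < n) `|f (I i).2 - f (I i).1|)%:E).
  rewrite -sumEFin big_mkord; apply: lee_sum => i _.
  have [le1 JE] := HI i.
  rewrite (@le_trans _ _ (f (I i).2 - f (I i).1)%:E)//; last first.
    by rewrite lee_fin ler_norm.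
  (* The right endpoint is added because the value of the measure is at hand for half-open
     intervals; an upper bound suffices. *)
  rewrite -lebesgue_stieltjes_itvoc//; apply: le_measure; rewrite ?inE//.
  rewrite JE; exact: subset_itv_oo_oc.
rewrite lee_fin ltW//; apply: (Heta n (fun i => I i)).
- by move=> i; exact: (HI i).1.
- move=> i j _ _; rewrite -(HI i).2 -(HI j).2 => /tJ ij.
  by apply: val_inj; exact: ij.
- rewrite -lte_fin (le_lt_trans _ Ueta)// UE.
  rewrite measure_bigcup//.
  apply: (@le_trans _ _ 
    (\sum_(0 <= i < n | i \in setT) lebesgue_measure (J i)))%E; last first.
    exact: nneseries_lim_ge.
  rewrite [leRHS](eq_bigl xpredT); last by move=> i; exact: mem_set.
  rewrite big_mkord -sumEFin.
  apply: lee_sum => i _; have [le1 ->] := HI i.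
  rewrite lebesgue_measure_itv/= lte_fin; case: ltP => // qp.
  by rewrite lee_fin subr_le0.
Qed.

(** For [a <= b], the projection of the line onto [a, b]; composing with it extends a function on
    [a, b] by constants. *)
Definition clamp (R : realType) (a b t : R) : R := Num.max a (Num.min t b).

Lemma clampP (R : realType) (a b t : R) : a <= b ->
  [\/ t <= a /\ clamp a b t = a, a <= t <= b /\ clamp a b t = t |
      b <= t /\ clamp a b t = b].
Proof.
move=> ab; rewrite /clamp.
have [tb|bt] := leP t b; last first.
  by apply: Or33; rewrite max_r// ltW.
have [at1|ta1] := leP a t; first by apply: Or32; split; lra.
by apply: Or31; rewrite ltW.
Qed.

(* Unlike [ge0_le_integral], no measurability is required: the integral of a
   nonnegative function is a supremum over the simple functions below it. *)
Lemma ge0_subfun_integral d (T : measurableType d) (R : realType)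
    (m : {measure set T -> \bar R}) (D : set T) (f1 f2 : T -> \bar R) :
  (forall x, D x -> 0 <= f1 x)%E -> (forall x, D x -> f1 x <= f2 x)%E ->
  (\int[m]_(x in D) f1 x <= \int[m]_(x in D) f2 x)%E.
Proof.
move=> f10 f12; rewrite !ge0_integralE//; last first.
  by move=> x Dx; rewrite (le_trans (f10 x Dx))// f12.
apply: ge_ereal_sup => _ [h /= hf1 <-].
apply: ereal_sup_ubound; exists h => // x.
by rewrite (le_trans (hf1 x))// lee_restrict.
Qed.

(** The positive part of [c * f] outside the exceptional null set [N] is a measurable minorant of
    [g]; elsewhere in [a, b] the bound [0 <= g] is enough. *)
Lemma ae_minorant_le_integral (R : realType) (a b c : R) (f g : R -> R) :
  0 <= c -> mu.-integrable setT (EFin \o f) ->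
  (forall t, t \in `[a, b] -> 0 <= g t) ->
  (\forall t \ae mu, t \in `]a, b[ -> c * f t <= g t) ->
  ((c * \int[mu]_(t in `]a, b]) f t)%:E <= \int[mu]_(t in `[a, b]) (g t)%:E)%E.
Proof.
move=> c0 intf g0 [N [mN N0 HN]].
have mf : measurable_fun setT f.
  by apply/measurable_EFinP; exact: (measurable_int _ intf).
pose h t := (c * Num.max (f t) 0)%:E.
have mh : measurable_fun setT h.
  apply/measurable_EFinP; apply: measurable_funM => //.
  exact: measurable_maxr.
have h0 t : (0 <= h t)%E by rewrite lee_fin mulr_ge0// le_max lexx orbT.
apply: (@le_trans _ _ (\int[mu]_(t in `]a, b[ `\` N) h t)%E); last first.
  rewrite [leLHS]integral_mkcond [leRHS]integral_mkcond.
  apply: ge0_subfun_integral => t _; first exact: erestrict_ge0.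
  rewrite /patch; case: ifPn => [|_]; last first.
    by case: ifPn => //; rewrite inE/= => /g0; rewrite lee_fin.
  rewrite inE => -[/= tab Nt].
  have tab' : t \in `[a, b] by exact: subset_itv_oo_cc.
  rewrite mem_set// /h lee_fin.
  have cfg : c * f t <= g t.
    by apply: contrapT => tg; apply: Nt; apply: HN => /(_ tab).
  have [_|_] := leP (f t) 0; last by rewrite cfg.
  by rewrite mulr0 g0.
(* [N] and the endpoint [b] are negligible for the measurable [h]. *)
rewrite -ge0_negligible_integral//; last exact: measurable_funTS.
rewrite integral_itv_bndo_bndc; last exact: measurable_funTS.
rewrite EFinM /Rintegral fineK; last first.
  by apply: integrable_fin_num => //; apply: integrableS intf.
rewrite -integralZl//; last by apply: integrableS intf.
rewrite [leLHS]integralE (le_trans (geeDl _ _))//.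
  by rewrite oppe_le0 integral_ge0.
apply: ge0_subfun_integral => t _ //.
rewrite funeposE /h -EFinM ge_max !lee_fin.
by rewrite ler_wpM2l ?le_max ?lexx//= mulr_ge0// le_max lexx orbT.
Qed.

Lemma ac_global_continuous (R : realType) (f : R -> R) :
  ac_global f -> continuous f.
Proof.
move=> acf x; apply/cvgrPdist_lt => e /acf[eta eta0 H].
near=> y.
pose I (i : 'I_1) : R * R := (Num.min x y, Num.max x y).
have := H 1%N I; rewrite !big_ord1 /I/=.
have -> : `|f (Num.max x y) - f (Num.min x y)| = `|f x - f y|.
  by rewrite maxEle minEle; case: ifP => _; rewrite // distrC.
apply.
- by move=> _; rewrite ge_min !le_max lexx.
- by move=> i j _ _ _; rewrite !ord1.
- have -> : Num.max x y - Num.min x y = `|x - y|.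
    rewrite maxEle minEle; case: leP => xy; last by rewrite gtr0_norm// subr_gt0.
    by rewrite ler0_norm ?subr_le0// opprB.
  by near: y; exact: cvgr_dist_lt.
Unshelve. all: by end_near. Qed.

(** [clamp] is nondecreasing and 1-Lipschitz: it carries disjoint open intervals to disjoint open
    intervals in [a, b] without increasing the total length. The factor [k] is absorbed by the
    tolerance [e * k]. *)
Lemma ac_global_clamp (R : realType) (a b k : R) (F : R -> R) :
  a <= b -> 0 < k -> abs_continuous a b F ->
  ac_global (fun t => (F (clamp a b t) - F a) / k).
Proof.
move=> ab k0 acF e e0.
have [eta eta0 H] := acF (e * k) (mulr_gt0 e0 k0).
exists eta => // n I le12 tI sI.
pose cl := clamp a b.
have := H n (fun i => (cl (I i).1, cl (I i).2)).
have cl_le s t : s <= t -> cl s <= cl t /\ cl t - cl s <= t - s.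
  by move=> st; rewrite /cl; case: (clampP s ab) => -[? ->];
    case: (clampP t ab) => -[? ->]; split; lra.
have -> : \sum_i `|(F (cl (I i).2) - F a) / k - (F (cl (I i).1) - F a) / k| =
   (\sum_i `|F (cl (I i).2) - F (cl (I i).1)|) / k.
  rewrite mulr_suml; apply: eq_bigr => i _.
  set u := F (cl (I i).2); set v := F (cl (I i).1).
  have -> : (u - F a) / k - (v - F a) / k = (u - v) / k by ring.
  by rewrite normrM [`|k^-1|]gtr0_norm ?invr_gt0.
rewrite ltr_pdivrMr//; apply.
- move=> i /=; have [le1 _] := cl_le _ _ (le12 i).
  move: le1; rewrite /cl; case: (clampP (I i).1 ab) => -[? ->];
    case: (clampP (I i).2 ab) => -[? ->] ?; split; lra.
- move=> i j _ _ [t [/= ti tj]]; apply: tI => //; exists t.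
  have cl_oo u v : t \in `]cl u, cl v[ -> u <= v -> t \in `]u, v[.
    rewrite !in_itv/= /cl; case: (clampP u ab) => -[? ->];
    case: (clampP v ab) => -[? ->]; lra.
  by split => /=; apply: cl_oo.
- apply: le_lt_trans sI; apply: ler_sum => i _.
  exact: (cl_le _ _ (le12 i)).2.
Qed.

(** Normalised to rise from 0 to 1 and extended by constants, [F] defines a finite measure, and the
    fundamental theorem of calculus identifies its Radon-Nikodym density with [F' / k] almost
    everywhere in ]a, b[. *)
Lemma ac_le_integral (R : realType) (a b c : R) (F g : R -> R) :
  a <= b -> {in `[a, b] &, {homo F : x y / x <= y}} -> abs_continuous a b F ->
  0 <= c -> (forall t, t \in `[a, b] -> 0 <= g t) ->
  (forall t, t \in `]a, b[ -> c * F^`()%classic t <= g t) ->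
  ((c * (F b - F a))%:E <= \int[mu]_(t in `[a, b]) (g t)%:E)%E.
Proof.
move=> ab ndF acF c0 g0 Fg.
have aab : a \in `[a, b] by rewrite in_itv/= lexx.
have bab : b \in `[a, b] by rewrite in_itv/= lexx andbT.
(* If [F a = F b], normalising by [k] is impossible, but the left side is then 0. *)
have := ndF _ _ aab bab ab; rewrite le_eqVlt => /orP[/eqP->|FaFb].
  by rewrite subrr mulr0 integral_ge0// => t /g0; rewrite lee_fin.
have altb : a < b.
  by rewrite lt_neqAle ab andbT; apply: contraTneq FaFb => ->; rewrite ltxx.
set k := F b - F a; have k0 : 0 < k by rewrite subr_gt0.
pose G t := (F (clamp a b t) - F a) / k.
have acG : ac_global G by exact: ac_global_clamp.
have ndG : {homo G : x y / x <= y}.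
  move=> x y xy; rewrite /G ler_pM2r ?invr_gt0// lerD2r ndF//.
  - by rewrite in_itv/=; case: (clampP x ab) => -[? ->]; lra.
  - by rewrite in_itv/=; case: (clampP y ab) => -[? ->]; lra.
  - by case: (clampP x ab) => -[? ->]; case: (clampP y ab) => -[? ->]; lra.
have rcG : right_continuous G.
  by move=> x; apply: cvg_at_right_filter; exact: ac_global_continuous.
have Gle t : t <= a -> G t = 0.
  move=> ta; rewrite /G; case: (clampP t ab) => -[h ->]; first by rewrite subrr mul0r.
    by have -> : t = a by [lra]; rewrite subrr mul0r.
  lra.
have Gge t : b <= t -> G t = 1.
  move=> bt; rewrite /G; case: (clampP t ab) => -[h ->]; last 1 first.
  - by rewrite divff// gt_eqF.
  - lra.
  - by have -> : t = b by [lra]; rewrite divff// gt_eqF.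
have GNy : G @ -oo --> (0 : R).
  apply: cvg_near_cst; near=> t; apply: Gle; near: t; exact/nbhs_ninfty_le/num_real.
have Gy : G @ +oo --> (1 : R).
  apply: cvg_near_cst; near=> t; apply: Gge; near: t; exact/nbhs_pinfty_ge/num_real.
pose cG : cumulativeBounded (0 : R) (1 : R) := HB.pack G
  (isCumulative.Build R _ R G ndG rcG) (isCumulativeBounded.Build R 0 1 G GNy Gy).
have domG : charge_of_finite_measure (lebesgue_stieltjes_measure cG) `<< mu.
  exact: (@ac_global_dominates R cG).

pose f := Radon_Nikodym (charge_of_finite_measure (lebesgue_stieltjes_measure cG)) mu.
have fE : EFin \o (fine \o f) = f.
  by apply/funext => t /=; rewrite fineK// Radon_Nikodym_fin_num.
have intf : mu.-integrable setT (EFin \o (fine \o f)).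
  by rewrite fE; exact: Radon_Nikodym_integrable.
have GE p x : p <= x ->
    \int[mu]_(t in `]p, x]) (fine \o f) t = G x - G p.
  move=> px; rewrite /Rintegral -[RHS]/(fine (G x - G p)%:E); congr fine.
  rewrite -(@lebesgue_stieltjes_itvoc R cG)//.
  rewrite [RHS](Radon_Nikodym_integral domG)//.
  by apply: eq_integral => t _; rewrite -/f -[in RHS]fE.
have -> : c * (F b - F a) = (c * k) * \int[mu]_(t in `]a, b]) (fine \o f) t.
  by rewrite GE// Gge// Gle// subr0 mulr1.
apply: ae_minorant_le_integral => //; first by rewrite mulr_ge0// ltW.
(* The base point [a - 1] lies strictly left of ]a, b[ and [G] vanishes there, so the primitive of
   the density is [G] itself to its right. *)
have := @FTC1 R (fine \o f) (BRight (a - 1)).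
move=> /(_ _ _)[y||N [mN N0 HN]].
- exact: integrableS intf.
- exact: open_integrable_locally openT intf.
exists N; split=> // t Ht; apply: HN => H; apply: Ht => tab.
move: (tab); rewrite in_itv/= => /andP[at1 tb].
have [|dF FE] := H; first by rewrite lte_fin; lra.
rewrite -mulrA (_ : k * _ = F^`()%classic t) ?Fg//.
rewrite -[X in k * X]FE.
move: dF; set Fi := (fun x : R => _) => dF.
(* Near [t] the function [F] equals [k *: Fi + F a]. *)
rewrite !derive1E (@near_eq_derive _ _ _ F (k *: Fi + cst (F a))); last first.
  near=> x.
  have xab : x \in `[a, b].
    by apply: subset_itv_oo_cc; near: x; exact: near_in_itvoo.
  move: (xab); rewrite in_itv/= => /andP[ax xb].
  rewrite /Fi /= !fctE GE; last by lra.
  rewrite (Gle (a - 1)); last by lra.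
  rewrite subr0 /G; case: (clampP x ab) => -[? ->].
  - have -> : x = a by lra.
    by rewrite subrr mul0r scaler0 add0r.
  - by rewrite [_ *: _]mulrC divfK ?gt_eqF// subrK.
  - have -> : x = b by lra.
    by rewrite [_ *: _]mulrC divfK ?gt_eqF// subrK.
rewrite deriveD//; last exact: derivableZ.
by rewrite deriveZ// derive_cst addr0.
Unshelve. all: by end_near. Qed.

(** * Length of curves *)

Section curve_length.
Context (R : realType) (M : metricType R).
Implicit Types (a b t : R) (g : R -> M) (h : R -> R) (s : seq R).

Lemma curve_variation_nil a g : curve_variation a g [::] = 0.
Proof. by rewrite /curve_variation big_nil. Qed.

Lemma curve_variation_cons a g x s :
  curve_variation a g (x :: s) = mdist (g a) (g x) + curve_variation x g s.
Proof.
rewrite /curve_variation /= big_nat_recl//=; congr (_ + _).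
rewrite big_nat [RHS]big_nat; apply: eq_bigr => i /andP[_ ilt].
by congr (mdist (g _) (g _)); apply: set_nth_default => //=; exact: ltnW.
Qed.

Lemma curve_variation_cat a g s1 s2 :
  curve_variation a g (s1 ++ s2) =
  curve_variation a g s1 + curve_variation (last a s1) g s2.
Proof.
elim: s1 a => [|x s1 IH] a /=; first by rewrite curve_variation_nil add0r.
by rewrite !curve_variation_cons IH addrA.
Qed.

Lemma curve_variation_ge0 a g s : 0 <= curve_variation a g s.
Proof. by apply: sumr_ge0 => i _; exact: mdist_ge0. Qed.

Lemma itv_partition_le_cons a b x s :
  itv_partition a b (x :: s) -> [/\ a < x, x <= b & itv_partition x b s].
Proof.
case=> /= /andP[ax xs] ls; have xb : itv_partition x b s by split.
by split=> //; exact: itv_partition_le xb.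
Qed.

(** The sum telescopes. Such a control function [h] for the increments of [g] carries all the upper
    bounds on lengths and speeds below. *)
Lemma curve_variation_le a b g h s :
  (forall u v, a <= u -> u <= v -> v <= b -> mdist (g u) (g v) <= h v - h u) ->
  itv_partition a b s -> curve_variation a g s <= h b - h a.
Proof.
elim: s a => [|x s IH] a H.
  by move=> /itv_partition_nil ->; rewrite curve_variation_nil subrr.
move=> /itv_partition_le_cons[ax xb pxs]; rewrite curve_variation_cons.
have := H a x (lexx a) (ltW ax) xb.
have := IH x _ pxs; have {}H u v (xu : x <= u) := H u v (le_trans (ltW ax) xu).
by move=> /(_ H); lra.
Qed.

Lemma curve_length_le a b g h :
  (forall u v, a <= u -> u <= v -> v <= b -> mdist (g u) (g v) <= h v - h u) ->
  (curve_length a b g <= (h b - h a)%:E)%E.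
Proof.
move=> H; apply: ge_ereal_sup => _ [s ps <-].
by rewrite lee_fin; exact: curve_variation_le ps.
Qed.

Lemma le_curve_length a b g s : itv_partition a b s ->
  ((curve_variation a g s)%:E <= curve_length a b g)%E.
Proof. by move=> ps; apply: ereal_sup_ubound; exists s. Qed.

Lemma itv_partition_segment a b : a <= b ->
  exists2 s, itv_partition a b s &
    forall g, curve_variation a g s = mdist (g a) (g b).
Proof.
rewrite le_eqVlt => /predU1P[<-|ab].
  by exists [::] => [|g]; rewrite ?curve_variation_nil ?mdistxx.
exists [:: b]; first exact: itv_partition1.
by move=> g; rewrite curve_variation_cons curve_variation_nil addr0.
Qed.

Lemma itv_partition_catW a t b s1 s2 :
  itv_partition a t s1 -> itv_partition t b s2 -> itv_partition a b (s1 ++ s2).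
Proof.
move=> [p1 /eqP l1] [p2 l2]; split; rewrite ?cat_path ?last_cat l1 ?p1//.
Qed.

Lemma curve_length_ge0 a b g : a <= b -> (0 <= curve_length a b g)%E.
Proof.
move=> /itv_partition_segment[s /(le_curve_length g) + _]; apply: le_trans.
by rewrite lee_fin curve_variation_ge0.
Qed.

Lemma mdist_le_curve_length a b g : a <= b ->
  ((mdist (g a) (g b))%:E <= curve_length a b g)%E.
Proof.
by move=> /itv_partition_segment[s ps sE]; rewrite -sE; exact: le_curve_length.
Qed.

Lemma mdist2_le_curve_length a t b g : a <= t -> t <= b ->
  ((mdist (g a) (g t) + mdist (g t) (g b))%:E <= curve_length a b g)%E.
Proof.
move=> /itv_partition_segment[s1 p1 s1E] /itv_partition_segment[s2 p2 s2E].
rewrite (le_trans _ (le_curve_length g (itv_partition_catW p1 p2)))// lee_fin.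
by rewrite curve_variation_cat s1E (eqP p1.2) s2E.
Qed.

Lemma mdist3_le_curve_length a t u b g : a <= t -> t <= u -> u <= b ->
  ((mdist (g a) (g t) + mdist (g t) (g u) + mdist (g u) (g b))%:E
     <= curve_length a b g)%E.
Proof.
move=> /itv_partition_segment[s1 p1 s1E] /itv_partition_segment[s2 p2 s2E].
move=> /itv_partition_segment[s3 p3 s3E].
have p12 := itv_partition_catW p1 p2.
rewrite (le_trans _ (le_curve_length g (itv_partition_catW p12 p3)))// lee_fin.
by rewrite !curve_variation_cat (eqP p12.2) s1E (eqP p1.2) s2E s3E.
Qed.

Lemma curve_length_homo a t b g : a <= t -> t <= b ->
  (curve_length a t g <= curve_length a b g)%E.
Proof.
move=> at1 /itv_partition_segment[s2 p2 _].
apply: ge_ereal_sup => _ [s ps <-].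
rewrite (le_trans _ (le_curve_length g (itv_partition_catW ps p2)))// lee_fin.
by rewrite curve_variation_cat lerDl curve_variation_ge0.
Qed.

(** Inserting [t] into the partition does not lower the variation, by the triangle inequality. *)
Lemma curve_variation_split a t b g s : itv_partition a b s ->
  a <= t -> t <= b -> exists s1 s2, [/\ itv_partition a t s1,
    itv_partition t b s2 &
    curve_variation a g s <= curve_variation a g s1 + curve_variation t g s2].
Proof.
elim: s a => [|x s IH] a.
  move=> /itv_partition_nil <- at1 ta.
  have -> : t = a by apply/eqP; rewrite eq_le ta at1.
  by exists [::], [::]; rewrite curve_variation_nil addr0.
move=> pxs; have [ax xb ps] := itv_partition_le_cons pxs.
rewrite le_eqVlt => /predU1P[<- ab|at1 tb].
  by exists [::], (x :: s); rewrite curve_variation_nil add0r.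
have [xt|tx] := leP x t.
  have [s1 [s2 [p1 p2 H]]] := IH x ps xt tb.
  exists (x :: s1), s2; split => //.
    by case: p1 => p1 l1; split => //=; rewrite ax.
  by rewrite !curve_variation_cons -addrA lerD2l.
exists [:: t], (x :: s); split; first exact: itv_partition1.
  by case: ps => p1 l1; split => //=; rewrite tx.
rewrite !curve_variation_cons curve_variation_nil addr0 addrA lerD2r.
exact: metric_triangle.
Qed.

Lemma curve_length_le_add a t b g h : a <= t -> t <= b ->
  (forall u v, t <= u -> u <= v -> v <= b -> mdist (g u) (g v) <= h v - h u) ->
  (curve_length a b g <= curve_length a t g + (h b - h t)%:E)%E.
Proof.
move=> at1 tb H; apply: ge_ereal_sup => _ [s ps <-].
have [s1 [s2 [p1 p2 s12]]] := curve_variation_split g ps at1 tb.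
apply: (@le_trans _ _ (curve_variation a g s1 + (h b - h t))%:E).
  by rewrite lee_fin (le_trans s12)// lerD2l; exact: curve_variation_le p2.
by rewrite EFinD leeD2r//; exact: le_curve_length.
Qed.

Lemma curve_length_fin a b g h :
  (forall u v, a <= u -> u <= v -> v <= b -> mdist (g u) (g v) <= h v - h u) ->
  a <= b -> curve_length a b g \is a fin_num.
Proof.
move=> /curve_length_le H ab; rewrite ge0_fin_numE ?curve_length_ge0//.
by rewrite (le_lt_trans H)// ltry.
Qed.

(** There is no partition, so [curve_length] is [-oo], which [fine] sends to 0. *)
Lemma length_fun_lt a t g : t < a -> length_fun a g t = 0.
Proof.
move=> ta; rewrite /length_fun /curve_length.
rewrite (_ : itv_partition a t = set0) ?image_set0 ?ereal_sup0//.
apply/seteqP; split => // s /itv_partition_le.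
by rewrite leNgt ta.
Qed.

Lemma length_funaa a g : length_fun a g a = 0.
Proof.
rewrite /length_fun; suff -> : curve_length a a g = 0%E by [].
apply/eqP; rewrite eq_le curve_length_ge0// andbT.
apply: ge_ereal_sup => _ [s ps <-]; case: s ps => [|x s].
  by rewrite curve_variation_nil.
by move=> /itv_partition_le_cons[]; rewrite ltNge => /negP.
Qed.

Lemma length_fun_homo a b g : curve_length a b g \is a fin_num ->
  forall u v, u <= v -> v <= b -> length_fun a g u <= length_fun a g v.
Proof.
move=> Hfin u v uv vb.
have fin t : a <= t -> t <= b -> curve_length a t g \is a fin_num.
  move=> at1 tb; rewrite ge0_fin_numE ?curve_length_ge0//.
  by rewrite (le_lt_trans (curve_length_homo g at1 tb))// ltey_eq Hfin.
have [au|ua] := leP a u.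
  have av := le_trans au uv.
  rewrite /length_fun fine_le ?fin//; first exact: le_trans vb.
  exact: curve_length_homo.
rewrite length_fun_lt//; have [av|va] := leP a v; last by rewrite length_fun_lt.
by rewrite fine_ge0// curve_length_ge0.
Qed.

Lemma length_fun_le a b g h :
  (forall u v, a <= u -> u <= v -> v <= b -> mdist (g u) (g v) <= h v - h u) ->
  forall u v, a <= u -> u <= v -> v <= b ->
  length_fun a g v - length_fun a g u <= h v - h u.
Proof.
move=> H u v au uv vb.
have av := le_trans au uv; have ub := le_trans uv vb.
have fin t : a <= t -> t <= b -> curve_length a t g \is a fin_num.
  move=> at1 tb; apply: (@curve_length_fin _ _ _ h) => // x y ax xy yt.
  by apply: H => //; exact: le_trans tb.
have := @curve_length_le_add a u v g h au uv
  (fun x y ux xy yv => H x y (le_trans au ux) xy (le_trans yv vb)).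
rewrite lerBlDl /length_fun -lee_fin [(fine _ + _)%:E]EFinD !fineK ?fin//.
Qed.

(** Only values to the left of [t] are compared, so that the right endpoint of a curve is covered,
    beyond which the length may be infinite. *)
Lemma derive1_ge0 (f : R -> R) t : (forall u, u < t -> f u <= f t) ->
  0 <= f^`()%classic t.
Proof.
move=> ft; rewrite /derive1.
have [cf|/dvgP->//] := pselect (cvg (h^-1 *: (f (h + t) - f t) @[h --> 0^'])).
apply: (cvgr_to_ge (cvg_dnbhs_at_left cf)).
near=> x.
have x0 : x < 0 by near: x; exact: nbhs_left_lt.
rewrite /GRing.scale/= mulr_le0// ?invr_le0 ?(ltW x0)// subr_le0 ft// gtrDr.
Unshelve. all: by end_near. Qed.

(* The left difference quotients of [length_fun] are nonnegative, so its
   derivative is too; where there is none [derive1] is 0. *)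
Lemma speed_ge0 a b g t : curve_length a b g \is a fin_num -> t <= b ->
  0 <= speed a g t.
Proof.
move=> Hfin tb; apply: derive1_ge0 => u ut.
exact: length_fun_homo Hfin _ _ (ltW ut) tb.
Qed.

Lemma derive1_le (f : R -> R) t k : 0 <= k ->
  (\forall u \near t, `|f u - f t| <= k * `|u - t|) -> f^`()%classic t <= k.
Proof.
move=> k0 ft; rewrite /derive1.
have [cf|/dvgP->//] := pselect (cvg (h^-1 *: (f (h + t) - f t) @[h --> 0^'])).
move: ft => /(@nbhs0P R R^o) ft0.
apply: (cvgr_to_le cf); near=> x.
have x0 : x != 0 by near: x; exact: nbhs_dnbhs_neq.

rewrite (le_trans (ler_norm _))// normrZ normfV ler_pdivrMl ?normr_gt0//.
rewrite mulrC.
have : `|f (t + x) - f t| <= k * `|t + x - t|.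
  by near: x; apply: cvg_within; exact: ft0.
by rewrite [t + x]addrC addrK.
Unshelve. all: by end_near. Qed.

End curve_length.

(** * Geodesics parametrised by arc length *)

Section geodesics.
Context (R : realType) (M : metricType R).

Lemma mdist_continuous (x : M) : continuous (mdist x).
Proof.
move=> y; apply/(@cvgrPdist_lt _ R^o) => e e0.
have : \forall z \near y, mdist y z < e.
  by apply/metricType_numDomainType.nbhs_mdistP; exists e.
apply: filterS => z yz.
have h1 := metric_triangle x y z; have h2 := metric_triangle x z y.
have h3 := metric_sym y z.
by rewrite ltr_norml; apply/andP; split; lra.
Qed.

Lemma curve_mdist_continuous a b (g : R -> M) x : {within `[a, b], continuous g} ->
  {within `[a, b], continuous (fun t => mdist x (g t))}.
Proof.
by move=> cg t; apply: continuous_comp; [exact: cg|exact: mdist_continuous].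
Qed.

(* [c u] is chosen on the given curve at distance [u] from [x]. *)
Lemma geodesic_param (x y : M) : geodesic_space M ->
  exists c : R -> M, [/\ c 0 = x, c (mdist x y) = y &
    forall u v, 0 <= u -> u <= v -> v <= mdist x y -> mdist (c u) (c v) = v - u].
Proof.
move=> /(_ x y)[a [b [g [[ab cg] ga gb gl]]]].
have H u : exists t, 0 <= u -> u <= mdist x y -> [/\ a <= t, t <= b & mdist x (g t) = u].
  have [/andP[u0 uxy]|nu] := boolP (0 <= u <= mdist x y); last first.
    by exists 0 => u0 u1; move: nu; rewrite u0 u1.
  have [||t tab tu] := @IVT R (fun t => mdist x (g t)) a b u ab.
  - exact: curve_mdist_continuous.
  - by rewrite /= ga gb mdistxx minEle maxEle mdist_ge0 u0 uxy.
  by exists t => _ _; move: tab; rewrite in_itv/= => /andP[].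
have [t Ht] := choice H.
(* The length of the curve equals the distance of its ends, so no triangle inequality along it is
   strict. *)
have key s s' : a <= s -> s <= s' -> s' <= b ->
    mdist (g s) (g s') = mdist x (g s') - mdist x (g s).
  move=> as' ss sb; apply/eqP; rewrite eq_le; apply/andP; split.
    have := mdist3_le_curve_length g as' ss sb; rewrite gl lee_fin ga gb.
    by have := metric_triangle x (g s') y; lra.
  by have := metric_triangle x (g s) (g s'); lra.
exists (g \o t); split => /=.
- have [||_ _ h] := Ht 0; rewrite ?mdist_ge0//.
  exact/esym/mdist_positivity.
- have [||t1 t2 h] := Ht (mdist x y); rewrite ?mdist_ge0//.
  have := mdist2_le_curve_length g t1 t2; rewrite gl lee_fin ga gb h.
  by move=> h2; apply: mdist_positivity; have := mdist_ge0 (g (t (mdist x y))) y; lra.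
- move=> u v u0 uv v1.
  have [||t1 t2 h] := Ht u => //; first exact: le_trans v1.
  have [||t1' t2' h'] := Ht v => //; first exact: le_trans uv.
  have [tt'|/ltW tt'] := leP (t u) (t v); first by rewrite key// h h'.
  (* If the chosen parameters come in reverse order, [key] gives [u - v >= 0], so [u = v]. *)
  rewrite metric_sym; have := key _ _ t1' tt' t2; rewrite h h' => kE.
  have := mdist_ge0 (g (t v)) (g (t u)); lra.
Qed.

End geodesics.

(** * The warping function *)

Section warping.
Context (R : realType) (alpha : R) (phi dphi : R -> R).
Hypothesis alpha0 : 0 < alpha.
Hypothesis phi1 : forall t : R, 0 <= t -> 1 <= phi t.
Hypothesis phiC1 : C1_halfline phi dphi.
Hypothesis phi_growth : forall t : R, 0 <= t -> alpha * phi t <= dphi t.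

Lemma warping_is_derive (t : R) : 0 < t -> is_derive t 1 phi (dphi t).
Proof.
move=> t0; have /cvgrPdist_lt H := phiC1.1 t (ltW t0).
have cq : h^-1 *: (phi (h + t) - phi t) @[h --> 0^'] --> dphi t.
  apply/cvgrPdist_lt => e /H; rewrite !near_withinE => He.
  have /(@nbhs0P R R^o) : \forall s \near t, 0 <= s /\ (s != t -> 0 <= s ->
      `|dphi t - (phi s - phi t) / (s - t)| < e).
    near=> s; split; last first.
      near: s; move: He; apply: filterS => s h st s0; apply: h => //.
      by rewrite /= in_itv/= s0.

    by apply: ltW; near: s; exact: lt_nbhsr.
  apply: filterS => h [/= s0 hs] h0.
  have th : t + h - t = h by rewrite addrC addKr.
  have tht : t + h != t by rewrite -subr_eq0 th.
  by have := hs tht s0; rewrite th [t + h]addrC [_ *: _]mulrC.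
apply: DeriveDef; last first.
  by rewrite -derive1E; apply/cvg_lim.
apply/cvg_ex; exists (dphi t).
by under eq_fun do rewrite /= [_%:A]mulr1.
Unshelve. all: by end_near. Qed.

(** Near 0 the difference quotients are bounded by [k], one more than [|dphi 0|], so
    [|phi t - phi 0| <= k * t]. *)
Lemma warping_cvg_right0 : phi t @[t --> 0^'+] --> phi 0.
Proof.
have /cvgrPdist_lt H := phiC1.1 0 (lexx 0).
have /H := @ltr01 R; rewrite !near_withinE => {}H.
pose k := `|dphi 0| + 1.
have k0 : 0 < k by rewrite ltr_wpDl.
apply/cvgrPdist_lt => e e0; near=> t.
have t0 : 0 < t by near: t; exact: nbhs_right_gt.
have tke : t < e / k by near: t; apply: nbhs_right_lt; rewrite divr_gt0.
have : `|dphi 0 - (phi t - phi 0) / (t - 0)| < 1.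
  have : 0 <= t -> t != 0 -> `|dphi 0 - (phi t - phi 0) / (t - 0)| < 1.
    by near: t; apply: cvg_within; move: H; apply: filterS => t h t0 tn;
    apply: h => //; rewrite /= in_itv/= t0.
  by apply; rewrite ?gt_eqF// ltW.
rewrite subr0 => h.
set q := (phi t - phi 0) / t in h.
have qk : `|q| < k.
  have -> : q = dphi 0 - (dphi 0 - q) by ring.
  by rewrite (le_lt_trans (ler_normB _ _))// ltrD2l.
have -> : phi 0 - phi t = - (q * t) by rewrite /q divfK ?gt_eqF// opprB.
rewrite normrN normrM (gtr0_norm t0).
apply: (@le_lt_trans _ _ (k * t)); first by rewrite ler_pM2r// ltW.
by rewrite mulrC -ltr_pdivlMr.
Unshelve. all: by end_near. Qed.

Lemma warping_continuous T : 0 < T -> {within `[0, T], continuous phi}.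
Proof.
have cphi t : 0 < t -> {for t, continuous phi}.
  move=> /warping_is_derive dt; apply: differentiable_continuous.
  by apply/derivable1_diffP; exact: ex_derive.
move=> T0; apply/(continuous_within_itvP _ T0); split.
- by move=> t; rewrite in_itv/= => /andP[/cphi].
- exact: warping_cvg_right0.
- by apply: cvg_at_left_filter; exact: cphi.
Qed.

(** The derivative of [phi u * expR (- (alpha * u))] is [(dphi u - alpha * phi u) * expR (- (alpha *
    u))], which is nonnegative. *)
Lemma warping_exp (s t : R) : 0 <= s -> s <= t ->
  phi s * expR (alpha * (t - s)) <= phi t.
Proof.
move=> s0; rewrite le_eqVlt => /predU1P[<-|st]; first by rewrite subrr mulr0 expR0 mulr1.
have t0 := le_lt_trans s0 st.
pose f := phi * (fun u : R => expR (- (alpha * u))).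
have dE (u : R) : is_derive u 1 (fun u : R => expR (- (alpha * u)))
    (- alpha * expR (- (alpha * u))).
  have dl : is_derive u 1 (fun u : R => - (alpha * u)) (- alpha).
    apply: is_deriveN; rewrite -[X in is_derive _ _ _ X]mulr1.
    exact: (@is_deriveZ _ _ _ id).
  have := @is_derive1_comp R expR (fun u => - (alpha * u)) u _ _ (is_derive_expR _) dl.
  by rewrite mulrC.
have df (u : R) : 0 < u -> is_derive u 1 f
    (phi u * (- alpha * expR (- (alpha * u))) + dphi u * expR (- (alpha * u))).
  move=> /warping_is_derive du; have := @is_deriveM _ _ _ _ _ _ _ _ du (dE u).
  by rewrite /GRing.scale/= [X in _ + X]mulrC.
have : f s <= f t.
  apply: (@ger0_derive1_le_cc _ f 0 t) => //.
  - by move=> u; rewrite in_itv/= => /andP[/df du _]; exact: ex_derive.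
  - move=> u; rewrite in_itv/= => /andP[u0 _]; rewrite derive1E.
    rewrite (@derive_val _ _ _ _ _ _ _ (df u u0)).
    have := phi_growth (ltW u0); have := expR_ge0 (- (alpha * u)); nra.
  - have := warping_continuous t0; move=> cphi u; apply: cvgM; first exact: cphi.
    apply: (continuous_subspaceT (f := fun u => expR (- (alpha * u)))) => v.
    by apply: differentiable_continuous; apply/derivable1_diffP; exact: ex_derive.
  - by rewrite in_itv/= s0 ltW.
  - by rewrite in_itv/= lexx andbT ltW.
  - exact: ltW.
rewrite /f /= !fctE => h.
have := expR_gt0 (alpha * t) => e0.
have := ler_wpM2r (ltW e0) h; rewrite -!mulrA -!expRD addNr expR0 mulr1.
by rewrite mulrBr addrC.
Qed.

Lemma warping_le (s t : R) : 0 <= s -> s <= t -> phi s <= phi t.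
Proof.
move=> s0 st; apply: le_trans (warping_exp s0 st).
rewrite ler_peMr//; first by rewrite (le_trans ler01)// phi1.
by rewrite -expR0 ler_expR mulr_ge0 ?subr_ge0// ltW.
Qed.

Lemma warping_lt (s t : R) : 0 <= s -> s < t -> phi s < phi t.
Proof.
move=> s0 st; apply: lt_le_trans (warping_exp s0 (ltW st)).
rewrite ltr_pMr//; last by rewrite (lt_le_trans ltr01)// phi1.
by rewrite -expR0 ltr_expR mulr_gt0 ?subr_gt0.
Qed.

Lemma warping_surj r : phi 0 <= r -> exists2 s, 0 <= s & phi s = r.
Proof.
(* [T] is chosen so that [phi T >= expR (alpha * T) >= 1 + alpha * T >= r]. *)
move=> r0; pose T := r / alpha + 1.
have r1 : 0 < r by rewrite (lt_le_trans ltr01)// (le_trans _ r0)// phi1.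
have T0 : 0 < T by rewrite addr_gt0// divr_gt0.
have rT : r <= phi T.
  apply: le_trans (warping_exp (lexx 0) (ltW T0)); rewrite subr0.
  rewrite (@le_trans _ _ (expR (alpha * T)))//; last first.
    by rewrite ler_peMl ?expR_ge0// phi1.
  apply: le_trans (expR_ge1Dx _).
  have -> : alpha * T = r + alpha by rewrite /T; field; rewrite gt_eqF.
  by move: alpha0; lra.
have [||s sT sr] := @IVT R phi 0 T r (ltW T0).
- exact: warping_continuous.
- by rewrite minEle maxEle warping_le ?(ltW T0)// r0 rT.
by exists s => //; move: sT; rewrite in_itv/= => /andP[].
Qed.

(** The height at which a move of length [d] in [Y] costs [2 / alpha]; it is [+oo] for [d = 0], and
    0 if the cost already exceeds [2 / alpha] at height 0. *)
Definition warping_psi (d : R) : \bar R := phi_inv phi (2%:E / (alpha * d)%:E)%E.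

Lemma warping_psi0 : warping_psi 0 = +oo%E.
Proof. by rewrite /warping_psi mulr0 inve0 gt0_muley// lte_fin. Qed.

Lemma warping_psi_gt0 d : 0 < d -> exists p, [/\ warping_psi d = p%:E, 0 <= p &
  phi p * (alpha * d) = 2 \/ p = 0 /\ 2 < phi 0 * (alpha * d)].
Proof.
move=> d0; have ad0 : 0 < alpha * d by rewrite mulr_gt0.
rewrite /warping_psi inver gt_eqF// -EFinM /phi_inv.
have [lt0|ge0] := ltP (2 / (alpha * d)) (phi 0).
  exists 0; split => //; right; split => //.
  by rewrite -ltr_pdivrMr.
have [s s0 sE] := warping_surj ge0.
set q := xget _ _; have [q0 qE] : 0 <= q /\ phi q = 2 / (alpha * d).
  by rewrite /q; case: xgetP => [_ -> //|/(_ s)]; case.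
by exists q; split => //; left; rewrite qE divfK// gt_eqF.
Qed.

Lemma warping_psi_ge0 d : 0 <= d -> (0 <= warping_psi d)%E.
Proof.
rewrite le_eqVlt => /predU1P[<-|/warping_psi_gt0[p [-> p0 _]]].
  by rewrite warping_psi0.
by rewrite lee_fin.
Qed.

Lemma le_warping_psi d t : 0 <= d -> 0 <= t -> phi t * (alpha * d) <= 2 ->
  (t%:E <= warping_psi d)%E.
Proof.
rewrite le_eqVlt => /predU1P[<-|d0]; first by rewrite warping_psi0 leey.
have ad0 : 0 < alpha * d by rewrite mulr_gt0.
have [p [-> p0 [pE|[-> p2]]]] := warping_psi_gt0 d0 => t0 t2; rewrite lee_fin.
  rewrite leNgt; apply/negP => pt.
  by move: t2; rewrite -pE ler_pM2r// leNgt warping_lt.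
have := le_lt_trans t2 p2; rewrite ltr_pM2r//.
by move=> h; have := warping_le (lexx 0) t0; lra.
Qed.

Lemma lt_warping_psi d t : 0 <= d -> 0 <= t -> (t%:E < warping_psi d)%E ->
  phi t * (alpha * d) < 2.
Proof.
rewrite le_eqVlt => /predU1P[<-|d0]; first by rewrite !mulr0.
have ad0 : 0 < alpha * d by rewrite mulr_gt0.
have [p [-> p0 [pE|[-> p2]]]] := warping_psi_gt0 d0 => t0; rewrite lte_fin => tp.
  by rewrite -pE ltr_pM2r// warping_lt.
by lra.
Qed.

(** Up to height [psi d] the cost is at most [2 / alpha], as [phi] increases. The term [phi 0 * d]
    serves the zero extension, where [t = 0] is forced. *)
Lemma warping_psi_cost d t : 0 <= d -> 0 <= t -> (t%:E <= warping_psi d)%E ->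
  phi t * d <= 2 / alpha + phi 0 * d.
Proof.
move=> d0 t0; have phi0 : 0 <= phi 0 by rewrite (le_trans ler01)// phi1.
have a2 : 0 <= 2 / alpha by rewrite divr_ge0// ltW.
move: d0; rewrite le_eqVlt => /predU1P[<-|d0]; first by rewrite !mulr0 addr0.
have ad0 : 0 < alpha * d by rewrite mulr_gt0.
have [p [-> p0 [pE|[-> p2]]]] := warping_psi_gt0 d0; rewrite lee_fin => tp.
  apply: (@le_trans _ _ (2 / alpha)); last by rewrite lerDl mulr_ge0// ltW.
  rewrite -pE ler_pdivlMr// -mulrA [d * _]mulrC ler_pM2r//.
  exact: warping_le.
have -> : t = 0 by lra.
by rewrite lerDr.
Qed.

(** At height [p] the cost [phi p * d] is at least [2 / alpha], and above [p] it grows by the factor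
    [expR (alpha * (m - p)) >= 1 + alpha * (m - p)]. *)
Lemma warping_psi_min d p m : 0 <= d -> 0 <= m -> warping_psi d = p%:E ->
  2 * (m - p) <= phi m * d.
Proof.
move=> d0 m0; move: d0; rewrite le_eqVlt => /predU1P[<-|d0].
  by rewrite warping_psi0.
have [q [-> p0 H]] := warping_psi_gt0 d0 => -[qp]; rewrite {}qp in p0 H *.
have phim : 0 <= phi m by rewrite (le_trans ler01)// phi1.
have [mp|pm] := leP m p.
  rewrite (@le_trans _ _ 0)//; last by rewrite mulr_ge0// ltW.
  by rewrite mulr_ge0_le0// subr_le0.
have h2 : 2 <= phi p * (alpha * d) by case: H => [->//|[-> /ltW]].
have h3 := warping_exp p0 (ltW pm).
have h4 := expR_ge1Dx (alpha * (m - p)).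
have phip : 0 <= phi p by rewrite (le_trans ler01)// phi1.
rewrite -(ler_pM2l alpha0).
have -> : alpha * (phi m * d) = phi m * (alpha * d) by ring.
apply: (@le_trans _ _ (phi p * expR (alpha * (m - p)) * (alpha * d))); last first.
  by rewrite ler_pM2r// mulr_gt0.
have -> : phi p * expR (alpha * (m - p)) * (alpha * d) =
  phi p * (alpha * d) * expR (alpha * (m - p)) by ring.
apply: (@le_trans _ _ (2 * expR (alpha * (m - p)))); last first.
  by rewrite ler_pM2r// expR_gt0.
by lra.
Qed.

(** Over a height of [ln k / alpha] the function [phi] gains at least the factor [k], so scaling [d]
    by [k] lowers [psi] by no more than that height. *)
Lemma warping_psi_log d k : 0 < d -> 1 <= k ->
  (warping_psi d <= warping_psi (k * d) + (ln k / alpha)%:E)%E.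
Proof.
move=> d0 k1; have k0 : 0 < k by rewrite (lt_le_trans ltr01).
have kd0 : 0 <= k * d by rewrite mulr_ge0// ltW.
have [p [pE p0 H]] := warping_psi_gt0 d0; rewrite pE.
have lnk : 0 <= ln k / alpha by rewrite divr_ge0 ?ln_ge0// ltW.
have [pk|kp] := leP p (ln k / alpha).
  apply: (@le_trans _ _ (0 + (ln k / alpha)%:E)%E); first by rewrite add0e lee_fin.
  by rewrite leeD2r// warping_psi_ge0.
have t0 : 0 <= p - ln k / alpha by rewrite subr_ge0 ltW.
rewrite -leeBlDr// -EFinB; apply: le_warping_psi => //.
have tp : p - ln k / alpha <= p by lra.
have aE : alpha * (p - (p - ln k / alpha)) = ln k by field; rewrite gt_eqF.
have := warping_exp t0 tp; rewrite aE lnK ?posrE// => h.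
case: H => [<-|[p00]]; last by move: kp; rewrite p00; lra.
rewrite (_ : _ * (alpha * (k * d)) =
  phi (p - ln k / alpha) * k * (alpha * d)); last by ring.
by rewrite ler_pM2r// mulr_gt0.
Qed.

End warping.

(** * The warped distance *)

(** Increments of the length function are bounded by those of [h], so it is 1-Lipschitz on
    [a, b]. *)
Lemma lipschitz_ac_curve (R : realType) (M : metricType R) (a b : R) (g : R -> M)
    (h : R -> R) : a <= b ->
  (forall u v, u <= v -> mdist (g u) (g v) <= h v - h u) ->
  (forall u v, u <= v -> h v - h u <= v - u) -> ac_curve a b g.
Proof.
move=> ab gh h1.
have ghab u v : a <= u -> u <= v -> v <= b -> mdist (g u) (g v) <= h v - h u.
  by move=> _ uv _; exact: gh.
have g1 u v : mdist (g u) (g v) <= `|u - v|.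
  have [uv|/ltW vu] := leP u v.
    by rewrite (le_trans (gh _ _ uv))// (le_trans (h1 _ _ uv))// distrC ler_norm.
  by rewrite metric_sym (le_trans (gh _ _ vu))// (le_trans (h1 _ _ vu))// ler_norm.
split.
- split=> //; apply: continuous_subspaceT => x.
  apply/metricType_numDomainType.cvgrPdist_lt => e e0; near=> y.
  by rewrite (le_lt_trans (g1 _ _))//; near: y; exact: cvgr_dist_lt.
- exact: curve_length_fin ghab ab.
- move=> e e0; exists e => // n I abI _ Ie; apply: le_lt_trans Ie.
  apply: ler_sum => i _; have [a1 [le12 b2]] := abI i.
  rewrite ger0_norm.
    by rewrite (le_trans (length_fun_le ghab a1 le12 b2))// h1.
  rewrite subr_ge0; apply: length_fun_homo le12 b2.
  exact: curve_length_fin ghab ab.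
Unshelve. all: by end_near. Qed.

Section clamp_theory.
Context (R : realType) (a b : R).
Hypothesis ab : a <= b.
Implicit Types t u v : R.

Lemma clamp_itv t : a <= clamp a b t <= b.
Proof. by case: (clampP t ab) => -[? ->]; move: ab; lra. Qed.

Lemma clamp_lo t : t <= a -> clamp a b t = a.
Proof. by move=> ?; case: (clampP t ab) => -[? ->]; move: ab; lra. Qed.

Lemma clamp_hi t : b <= t -> clamp a b t = b.
Proof. by move=> ?; case: (clampP t ab) => -[? ->]; move: ab; lra. Qed.

Lemma clamp_le u v : u <= v -> clamp a b u <= clamp a b v.
Proof.
by move=> uv; case: (clampP u ab) => -[? ->];
  case: (clampP v ab) => -[? ->]; move: ab; lra.
Qed.

Lemma clamp_lip u v : u <= v -> clamp a b v - clamp a b u <= v - u.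
Proof.
by move=> uv; case: (clampP u ab) => -[? ->];
  case: (clampP v ab) => -[? ->]; move: ab; lra.
Qed.

End clamp_theory.

(* The geodesics [x, q] and [q, x'] run through one after the other, with a
   pause of duration [B] at [q]; [h] is the distance run so far. *)
Lemma broken_geodesic (R : realType) (X : metricType R) (x q x' : X) (B : R) :
  geodesic_space X -> 0 <= B ->
  let A := mdist x q in let L := A + B + mdist q x' in
  exists (g : R -> X) (h : R -> R), [/\ g 0 = x, g L = x',
    forall t, A <= t <= A + B -> g t = q,
    h L - h 0 = A + mdist q x' &
    forall u v, u <= v -> mdist (g u) (g v) <= h v - h u <= v - u].
Proof.
move=> geoX B0 A L.
have [c1 [c10 c1A c1d]] := geodesic_param x q geoX.
have [c3 [c30 c3C c3d]] := geodesic_param q x' geoX.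
move: @L; rewrite -/A in c1A c1d *; set C := mdist q x' in c3C c3d * => L.
have A0 : 0 <= A by exact: mdist_ge0.
have C0 : 0 <= C by exact: mdist_ge0.
have AB0 : 0 <= A + B by exact: addr_ge0.
pose p1 := clamp 0 A; pose p3 (t : R) := clamp 0 C (t - (A + B)).
have p1A t : A + B <= t -> p1 t = A by move=> h; rewrite /p1 clamp_hi//; lra.
have p30 t : t <= A + B -> p3 t = 0 by move=> h; rewrite /p3 clamp_lo// subr_le0.
have h1 t : 0 <= p1 t <= A by exact: clamp_itv.
have h3 t : 0 <= p3 t <= C by exact: clamp_itv.
have le1 u v : u <= v -> p1 u <= p1 v by exact: clamp_le.
have le3 u v : u <= v -> p3 u <= p3 v.
  by move=> uv; apply: clamp_le => //; rewrite lerD2r.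
have lip1 u v : u <= v -> p1 v - p1 u <= v - u by exact: clamp_lip.
have lip3 u v : u <= v -> p3 v - p3 u <= v - u.
  move=> uv; have := @clamp_lip _ _ _ C0 (u - (A + B)) (v - (A + B)).
  by rewrite lerD2r -/(p3 u) -/(p3 v) => /(_ uv); rewrite opprB addrA subrK.
pose g (t : R) := if t <= A + B then c1 (p1 t) else c3 (p3 t).
exists g, (fun t => p1 t + p3 t); split.
- by rewrite /g AB0 /p1 clamp_lo.
(* If [C = 0], the time [L] still falls in the first branch of [g], and [q = x']. *)
- rewrite /g /L; have [LAB|_] := boolP (A + B + C <= A + B).
    have CE : C = 0 by apply/eqP; rewrite eq_le C0 andbT; move: LAB; rewrite gerDl.
    by rewrite p1A ?CE ?addr0// c1A -c30 -c3C CE.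
  by rewrite /p3 addrC addKr clamp_hi.
- by move=> t /andP[At tAB]; rewrite /g tAB /p1 clamp_hi.
- rewrite (p1A L) ?(p30 0)//; last by rewrite /L lerDl.
  have -> : p3 L = C by rewrite /p3 /L [X in X - _]addrC addrK clamp_hi.
  have -> : p1 0 = 0 by rewrite /p1 clamp_lo.
  by rewrite addr0 subr0.
- move=> u v uv; have le1uv := le1 _ _ uv; have le3uv := le3 _ _ uv.
  have /andP[u1 u1'] := h1 u; have /andP[v1 v1'] := h1 v.
  have /andP[u3 u3'] := h3 u; have /andP[v3 v3'] := h3 v.
  rewrite /g; have [uAB|uAB] := boolP (u <= A + B);
    have [vAB|vAB] := boolP (v <= A + B).
  + by rewrite c1d// !p30// !addr0 lexx lip1.
  + have /ltW vAB' : A + B < v by rewrite ltNge.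
    rewrite (p30 u)// (p1A v)// addr0; apply/andP; split.
      rewrite (le_trans (metric_triangle _ q _))// addrAC lerD//.
        by have := c1d _ _ u1 u1' (lexx A); rewrite c1A => ->.
      by have := c3d _ _ (lexx 0) v3 v3'; rewrite c30 subr0 => ->.
    have l1 := lip1 _ _ uAB; have l3 := lip3 _ _ vAB'.
    by move: l1 l3; rewrite (p1A (A + B))// (p30 (A + B))//; clear; lra.
  + by move: uAB; rewrite (le_trans uv vAB).
  + have /ltW uAB' : A + B < u by rewrite ltNge.
    have /ltW vAB' : A + B < v by rewrite ltNge.
    rewrite (p1A u)// (p1A v)// c3d// opprD addrACA subrr add0r lexx.
    exact: lip3.
Qed.

(** The increments of [length_fun 0 g] lie between 0 and those of [h], also at negative parameters,
    where it vanishes; a local Lipschitz bound on [h] at [t] therefore bounds the speed. *)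
Lemma speed_le (R : realType) (M : metricType R) (k t : R) (g : R -> M)
    (h : R -> R) : 0 <= k ->
  (forall u v, u <= v -> mdist (g u) (g v) <= h v - h u) ->
  (\forall u \near t, `|h u - h t| <= k * `|u - t|) -> speed 0 g t <= k.
Proof.
move=> k0 gh near_t.
have h_le u v : u <= v -> h u <= h v.
  by move=> uv; rewrite -subr_ge0; exact: le_trans (mdist_ge0 _ _) (gh _ _ uv).
have lf u v : u <= v -> 0 <= length_fun 0 g v - length_fun 0 g u <= h v - h u.
  move=> uv.
  have fin (r : R) : 0 <= r -> curve_length 0 r g \is a fin_num.
    by apply: (@curve_length_fin _ _ _ _ _ h) => x1 x2 _ + _; exact: gh.
  have [v0|v0] := boolP (0 <= v); last first.
    have v0' : v < 0 by rewrite ltNge.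
    by rewrite !length_fun_lt ?(le_lt_trans uv)// subrr lexx subr_ge0 h_le.
  rewrite subr_ge0 (length_fun_homo (fin v v0))//=.
  have [u0|u0] := boolP (0 <= u).
    by apply: (@length_fun_le _ _ 0 v) => // x1 x2 _ + _; exact: gh.
  have u0' : u < 0 by rewrite ltNge.
  have : length_fun 0 g v - length_fun 0 g 0 <= h v - h 0.
    by apply: (@length_fun_le _ _ 0 v) => // x1 x2 _ + _; exact: gh.
  rewrite (length_fun_lt _ u0') length_funaa => /le_trans; apply.
  by rewrite lerD2l lerN2 h_le// ltW.
apply: derive1_le => //; apply: filterS near_t => u; apply: le_trans.
have [ut|tu] := orP (le_total u t).
  have /andP[l1 l2] := lf _ _ ut.
  by rewrite distrC ger0_norm// distrC ger0_norm ?subr_ge0 ?h_le.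
have /andP[l1 l2] := lf _ _ tu.
by rewrite ger0_norm// ger0_norm ?subr_ge0 ?h_le.
Qed.

(** The counterpart in [Y] of [broken_geodesic]: it moves only during the pause [A, A + B] of the
    latter. *)
Lemma delayed_geodesic (R : realType) (Y : metricType R) (y y' : Y) (A : R) :
  geodesic_space Y -> let B := mdist y y' in
  exists (g : R -> Y) (h : R -> R), [/\
    forall t, t <= A -> g t = y, forall t, A + B <= t -> g t = y',
    forall u v, u <= v -> mdist (g u) (g v) <= h v - h u <= v - u &
    forall t, speed 0 g t <= 1 /\ (~~ (A <= t <= A + B) -> speed 0 g t <= 0)].
Proof.
move=> geoY B; have [c [c0 cB cd]] := geodesic_param y y' geoY.
have B0 : 0 <= B by exact: mdist_ge0.
pose h (t : R) := clamp 0 B (t - A).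
have hlo t : t <= A -> h t = 0 by move=> tA; rewrite /h clamp_lo// subr_le0.
have hhi t : A + B <= t -> h t = B by move=> tA; rewrite /h clamp_hi// lerBrDl.
have hle u v : u <= v -> h u <= h v by move=> uv; rewrite clamp_le// lerD2r.
have hlip u v : u <= v -> h v - h u <= v - u.
  move=> uv; have := @clamp_lip _ _ _ B0 (u - A) (v - A).
  by rewrite lerD2r -/(h u) -/(h v) => /(_ uv); rewrite opprB addrA subrK.
have gh u v : u <= v -> mdist (c (h u)) (c (h v)) <= h v - h u.
  move=> uv; have /andP[h0 _] := clamp_itv B0 (u - A).
  have /andP[_ hB] := clamp_itv B0 (v - A).
  by rewrite cd// hle.
exists (c \o h), h; split => /=.
- by move=> t tA; rewrite hlo.
- by move=> t tA; rewrite hhi.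
- by move=> u v uv; rewrite gh// hlip.
move=> t; split.
  apply: (@speed_le _ _ 1 t _ h) => //; near=> u; rewrite mul1r.
  have [ut|tu] := orP (le_total u t).
    by rewrite distrC ger0_norm ?subr_ge0 ?hle// distrC ger0_norm ?subr_ge0 ?hlip.
  by rewrite !ger0_norm ?subr_ge0 ?hle ?hlip.
rewrite negb_and -!ltNge => /orP[tA|ABt];
  apply: (@speed_le _ _ 0 t _ h) => //; near=> u.
  have /ltW uA : u < A by near: u; exact: lt_nbhsl.
  by rewrite (hlo u uA) (hlo t (ltW tA)) subrr normr0 mul0r.
have /ltW uA : A + B < u by near: u; exact: lt_nbhsr.
by rewrite (hhi u uA) (hhi t (ltW ABt)) subrr normr0 mul0r.
Unshelve. all: by end_near. Qed.

(** * Competitor curves for the warped distance *)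

Section warped_upper.
Context (R : realType) (X Y : metricType R) (x0 : X) (phi : R -> R).
Hypotheses (geoX : geodesic_space X) (geoY : geodesic_space Y).
Hypothesis phi0 : forall t : R, 0 <= t -> 0 <= phi t.

Lemma warped_length_ge0 a b (gX : R -> X) (gY : R -> Y) : ac_curve a b gY -> a <= b ->
  (0 <= \int[mu]_(t in `[a, b]) (phi (mdist (gX t) x0) * speed a gY t)%:E)%E.
Proof.
move=> [_ finY _] ab; apply: integral_ge0 => t /=; rewrite in_itv/= => /andP[_ tb].
by rewrite lee_fin mulr_ge0// ?phi0 ?mdist_ge0// (speed_ge0 finY).
Qed.

(** The curve runs in [X] from [x] to [q], then in [Y] over the fixed point [q], then in [X] from
    [q] to [x']. *)
Lemma warped_curve (x x' q : X) (y y' : Y) : exists a b gX gY,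
  [/\ ac_curve a b gX, ac_curve a b gY, (gX a, gY a) = (x, y),
      (gX b, gY b) = (x', y') &
      (warped_length x0 phi a b gX gY <= (mdist x q + mdist q x' +
        phi (mdist q x0) * mdist y y')%:E)%E].
Proof.
have B0 : 0 <= mdist y y' by exact: mdist_ge0.
have A0 : 0 <= mdist x q by exact: mdist_ge0.
have [gX [hX []]] := broken_geodesic x q x' geoX B0.
have [gY [hY []]] := delayed_geodesic y y' (mdist x q) geoY.
move=> gYlo gYhi gYh sp; set L := _ + _ + mdist q x' => gX0 gXL gXq hXL gXh.
move: gYhi sp gXq @L gXL hXL.
set A := mdist x q; set B := mdist y y'; set C := mdist q x'.
move=> gYhi sp gXq L gXL hXL.
have L0 : 0 <= L by rewrite !addr_ge0 ?mdist_ge0.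
have gXh1 u v : u <= v -> mdist (gX u) (gX v) <= hX v - hX u by case/gXh/andP.
have gYh1 u v : u <= v -> mdist (gY u) (gY v) <= hY v - hY u by case/gYh/andP.
have acX : ac_curve 0 L gX.
  by apply: lipschitz_ac_curve gXh1 _ => // u v /gXh/andP[].
have acY : ac_curve 0 L gY.
  by apply: lipschitz_ac_curve gYh1 _ => // u v /gYh/andP[].
exists 0, L, gX, gY; split => //.
- by rewrite gX0 gYlo.
- by rewrite gXL gYhi// lerDl mdist_ge0.
rewrite /warped_length EFinD leeD//.
  rewrite -hXL; apply: curve_length_le => u v _ uv _; exact: gXh1.
set K := phi (mdist q x0); have K0 : 0 <= K by rewrite phi0// mdist_ge0.
have [_ finY _] := acY.
pose J := `[A, A + B]%classic : set (measurableTypeR R).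
have mJ : measurable J by exact: measurable_itv.
pose cK : measurableTypeR R -> \bar R := fun=> K%:E.
(* The integrand is at most [K] on the pause [J] and at most 0 off it. *)
apply: (@le_trans _ _ (\int[mu]_(t in `[0%R, L]) (cK \_ J) t)%E).
  apply: ge0_subfun_integral => t /=; rewrite in_itv/= => /andP[t0 tL].
    by rewrite lee_fin mulr_ge0 ?phi0 ?mdist_ge0// (speed_ge0 finY).
  rewrite patchE; case: ifPn => tJ.
    have tAB : A <= t <= A + B by move: tJ; rewrite inE /J /= in_itv.
    by rewrite gXq// lee_fin -/K ler_piMr// (sp t).1.
  have tAB : ~~ (A <= t <= A + B).
    by apply: contra tJ => tAB; rewrite inE /J /= in_itv.
  by rewrite lee_fin mulr_ge0_le0 ?phi0 ?mdist_ge0// (sp t).2.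
rewrite -integral_mkcondr integral_cst//; last exact: measurableI.
apply: (@le_trans _ _ (K%:E * mu J))%E.
  rewrite lee_wpmul2l//; apply: le_measure; rewrite ?inE//;
    by [exact: measurableI|exact: subIsetr|exact: subIsetl].
rewrite lebesgue_measure_itv/= lte_fin; case: ltP => _.
  by rewrite -EFinB -EFinM addrC addKr.
by rewrite mule0 lee_fin mulr_ge0.
Unshelve. all: by end_near. Qed.

End warped_upper.

(** [diam] is a real [sup], so the set of distances must first be bounded: it is, by twice the
    distance from [y] to a farthest point [z]. *)
Lemma compact_mdist_le_diam (R : realType) (Y : metricType R) (y y' : Y) :
  compact [set: Y] -> mdist y y' <= diam Y.
Proof.
move=> cY; apply: ub_le_sup; last by exists y, y'.
have [||z _ Hz] := @compact_EVT_max Y R (mdist y) setT _ cY.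
- by exists y.
- exact/continuous_subspaceT/mdist_continuous.
exists (mdist y z + mdist y z) => _ [u [v ->]].
have hu : mdist y u <= mdist y z by apply: Hz; rewrite inE.
have hv : mdist y v <= mdist y z by apply: Hz; rewrite inE.
by have := metric_triangle u y v; rewrite [mdist u y]metric_sym; lra.
Qed.

(** * Gromov products in the warped product *)

Section warped_dist.
Context (R : realType) (X Y : metricType R) (x0 : X) (y0 : Y)
  (delta alpha : R) (phi dphi : R -> R).
Hypothesis geoX : geodesic_space X.
Hypothesis delta0 : 0 <= delta.
Hypothesis hypX : gromov_hyperbolic (@mdist R X) delta.
Hypothesis cY : compact [set: Y].
Hypothesis geoY : geodesic_space Y.
Hypothesis alpha0 : 0 < alpha.
Hypothesis phi1 : forall t : R, 0 <= t -> 1 <= phi t.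
Hypothesis phiC1 : C1_halfline phi dphi.
Hypothesis phi_growth : forall t : R, 0 <= t -> alpha * phi t <= dphi t.

Implicit Types (x q : X) (y : Y).

Let phi_ge0 (t : R) : 0 <= t -> 0 <= phi t.
Proof. by move=> t0; rewrite (le_trans ler01)// phi1. Qed.

Let phi_le := warping_le alpha0 phi1 phiC1 phi_growth.

(** [m] is the least distance to [x0] along [gX]: the [X]-part descends to that height and climbs
    back, and the weight of the [Y]-part is at least [phi m] throughout. *)
Lemma warped_length_lower a b (gX : R -> X) (gY : R -> Y) :
  ac_curve a b gX -> ac_curve a b gY ->
  exists2 m, 0 <= m &
    ((mdist (gX a) x0 + mdist (gX b) x0 - 2 * m + phi m * mdist (gY a) (gY b))%:E
      <= warped_length x0 phi a b gX gY)%E.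
Proof.
move=> [[ab cX] finX _] [[_ _] finY acY].
have [|tau tab Htau] := @EVT_min R (fun t => mdist x0 (gX t)) a b ab.
  exact: curve_mdist_continuous.
move: tab; rewrite in_itv/= => /andP[atau taub].
pose m := mdist x0 (gX tau); have m0 : 0 <= m by exact: mdist_ge0.
exists m => //; rewrite /warped_length EFinD leeD//.
  apply: le_trans (mdist2_le_curve_length gX atau taub); rewrite lee_fin.
  have h1 := metric_triangle (gX a) (gX tau) x0.
  have h2 := metric_triangle (gX b) (gX tau) x0.
  by rewrite [mdist (gX tau) (gX b)]metric_sym; move: h1 h2;
    rewrite [mdist (gX tau) x0]metric_sym -/m; lra.
have homo := length_fun_homo finY.
apply: (@le_trans _ _ (phi m * (length_fun a gY b - length_fun a gY a))%:E).
  rewrite lee_fin ler_wpM2l ?phi_ge0// length_funaa subr0 -lee_fin.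
  by rewrite /length_fun fineK// mdist_le_curve_length.
apply: ac_le_integral => //.
- by move=> u v _; rewrite in_itv/= => /andP[_ vb] uv; exact: homo.
- exact: phi_ge0.
- move=> t; rewrite in_itv/= => /andP[_ tb].
  by rewrite mulr_ge0 ?phi_ge0 ?mdist_ge0// (speed_ge0 finY).
- move=> t; rewrite in_itv/= => /andP[/ltW a_t /ltW tb].
  rewrite ler_wpM2r ?(speed_ge0 finY)// phi_le// [leRHS]metric_sym.
  by apply: Htau; rewrite in_itv/= a_t tb.
Qed.

Lemma mdist_le_warped_length a b (gX : R -> X) (gY : R -> Y) :
  ac_curve a b gX -> ac_curve a b gY ->
  ((mdist (gX a) (gX b))%:E <= warped_length x0 phi a b gX gY)%E.
Proof.
move=> [[ab _] _ _] acY; rewrite /warped_length -[leLHS]adde0 leeD//.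
  exact: mdist_le_curve_length.
exact: warped_length_ge0.
Qed.

Let warped_lengths (z w : X * Y) : set (\bar R) :=
  [set l | exists (a b : R) (gX : R -> X) (gY : R -> Y),
    [/\ ac_curve a b gX, ac_curve a b gY, (gX a, gY a) = z, (gX b, gY b) = w &
        l = warped_length x0 phi a b gX gY]].

(** The infimum lies between 0 and the length of a competitor, so [fine] loses nothing. *)
Lemma warped_dist_fin z w :
  ereal_inf (warped_lengths z w) = (warped_dist x0 phi z w)%:E.
Proof.
case: z w => [x y] [x' y'].
have [a [b [gX [gY [acX acY ga gb le_len]]]]] :=
  warped_curve x0 geoX geoY phi_ge0 x x' x y y'.
rewrite /warped_dist fineK// fin_numElt; apply/andP; split.
  apply: (@lt_le_trans _ _ 0%E) => //.
  apply: le_ereal_inf_tmp => _ [a' [b' [gX' [gY' [cX' cY' _ _ ->]]]]].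
  apply: le_trans (mdist_le_warped_length cX' cY').
  by rewrite lee_fin mdist_ge0.
apply: le_lt_trans (ltry _); apply: le_trans le_len.
by apply: ereal_inf_lbound; exists a, b, gX, gY.
Qed.

Lemma warped_dist_ge x y x' y' r :
  (forall a b (gX : R -> X) (gY : R -> Y), ac_curve a b gX -> ac_curve a b gY ->
    (gX a, gY a) = (x, y) -> (gX b, gY b) = (x', y') ->
    (r%:E <= warped_length x0 phi a b gX gY)%E) ->
  r <= warped_dist x0 phi (x, y) (x', y').
Proof.
move=> H; rewrite -lee_fin -warped_dist_fin.
by apply: le_ereal_inf_tmp => _ [a [b [gX [gY [? ? ? ? ->]]]]]; exact: H.
Qed.

Lemma warped_dist_le x y x' y' q :
  warped_dist x0 phi (x, y) (x', y') <=
  mdist x q + mdist q x' + phi (mdist q x0) * mdist y y'.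
Proof.
have [a [b [gX [gY [acX acY ga gb le_len]]]]] :=
  warped_curve x0 geoX geoY phi_ge0 x x' q y y'.
rewrite -lee_fin -warped_dist_fin; apply: le_trans le_len.
by apply: ereal_inf_lbound; exists a, b, gX, gY.
Qed.

Lemma mdist_le_warped_dist x y x' y' :
  mdist x x' <= warped_dist x0 phi (x, y) (x', y').
Proof.
apply: warped_dist_ge => a b gX gY acX acY [<- _] [<- _].
exact: mdist_le_warped_length.
Qed.

Local Notation psi := (warping_psi alpha phi).
Local Notation GX := (gromov_prod (@mdist R X) x0).
Local Notation GZ := (gromov_prod (warped_dist x0 phi) (x0, y0)).

Lemma warped_dist_psi_ge x y x' y' p : psi (mdist y y') = p%:E ->
  mdist x x0 + mdist x' x0 - 2 * p <= warped_dist x0 phi (x, y) (x', y').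
Proof.
move=> psip; apply: warped_dist_ge => a b gX gY acX acY [gxa gya] [gxb gyb].
have [m m0] := warped_length_lower acX acY.
rewrite gxa gxb gya gyb; apply: le_trans; rewrite lee_fin.
have := warping_psi_min alpha0 phi1 phiC1 phi_growth (mdist_ge0 y y') m0 psip.
by rewrite mulrBr; lra.
Qed.

(** For the upper bound, the whole move in [Y] is made over [x0], where it costs at most
    [phi 0 * diam Y]. *)
Lemma warped_dist_base x y :
  mdist x x0 <= warped_dist x0 phi (x, y) (x0, y0) <= mdist x x0 + phi 0 * diam Y.
Proof.
rewrite mdist_le_warped_dist/=; apply: le_trans (warped_dist_le _ _ _ _ x0) _.
rewrite !mdistxx addr0 lerD2l ler_wpM2l ?phi_ge0//.
exact: compact_mdist_le_diam.
Qed.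

Lemma gromov_prod_mdist_ge0 (x x' : X) : 0 <= GX x x'.
Proof.
rewrite /gromov_prod divr_ge0// subr_ge0.
by rewrite [mdist x' x0]metric_sym metric_triangle.
Qed.

Lemma warped_prod_le x y x' y' : GZ (x, y) (x', y') <= GX x x' + phi 0 * diam Y.
Proof.
have /andP[_ h1] := warped_dist_base x y; have /andP[_ h2] := warped_dist_base x' y'.
have := mdist_le_warped_dist x y x' y'; rewrite /gromov_prod.
set P := phi 0 * diam Y in h1 h2 *.
by lra.
Qed.

Lemma warped_prod_le_psi x y x' y' :
  ((GZ (x, y) (x', y'))%:E <= psi (mdist y y') + (phi 0 * diam Y)%:E)%E.
Proof.
have /andP[_ h1] := warped_dist_base x y; have /andP[_ h2] := warped_dist_base x' y'.
have := mdist_ge0 y y'; rewrite le_eqVlt => /predU1P[<-|d0].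
  by rewrite warping_psi0 // addye ?leey.
have [p [pE _ _]] := warping_psi_gt0 alpha0 phi1 phiC1 phi_growth d0.
rewrite pE -EFinD lee_fin.
have := warped_dist_psi_ge x x' pE; rewrite /gromov_prod.
set P := phi 0 * diam Y in h1 h2 *.
by lra.
Qed.

(* The competitor moves in [Y] over the point [q] of the geodesic [x0, x] at
   height [t]; hyperbolicity makes the detour through [q] cost at most
   [2 * delta]. *)
Lemma warped_prod_ge x y x' y' t : 0 <= t -> t <= GX x x' ->
  (t%:E <= psi (mdist y y'))%E ->
  t <= GZ (x, y) (x', y') + (delta + alpha^-1 + phi 0 * diam Y).
Proof.
move=> t0 tG tpsi.
have /andP[h1 _] := warped_dist_base x y; have /andP[h2 _] := warped_dist_base x' y'.
have tx : t <= mdist x x0.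
  rewrite (le_trans tG)// /gromov_prod.
  by have := metric_triangle x' x x0; rewrite [mdist x' x]metric_sym; lra.
have [c [c0 c1 cd]] := geodesic_param x0 x geoX.
rewrite metric_sym in tx.
pose q := c t.
have q0 : mdist q x0 = t by rewrite metric_sym -c0 cd// subr0.
have qx : mdist x q = mdist x x0 - t.
  by rewrite metric_sym -[X in mdist _ X]c1 cd// metric_sym.
(* Since [(q|x) = t] and [(x|x') >= t], hyperbolicity gives [(q|x') >= t - delta]. *)
have qx' : mdist q x' <= mdist x' x0 - t + 2 * delta.
  have := hypX q x' x x0.
  have -> : GX q x = t by rewrite /gromov_prod q0 [mdist q x]metric_sym qx; lra.
  have -> : GX x' x = GX x x'.
    by rewrite /gromov_prod [mdist x' x]metric_sym [_ + mdist x' x0]addrC.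
  by rewrite min_l// /gromov_prod q0; lra.
have cost := warping_psi_cost alpha0 phi1 phiC1 phi_growth (mdist_ge0 y y') t0 tpsi.
have dD : phi 0 * mdist y y' <= phi 0 * diam Y.
  by rewrite ler_wpM2l ?phi_ge0//; exact: compact_mdist_le_diam.
(* The distance exceeds [d(x, x0) + d(x', x0) - 2 t] by at most [2 delta + 2 / alpha + P], which the
   Gromov product halves. *)
have := warped_dist_le x y x' y' q; rewrite q0 qx /gromov_prod.
set P := phi 0 * diam Y in dD *; set Q := phi 0 * mdist y y' in dD cost *.
have P0 : 0 <= P by rewrite (le_trans _ dD)// mulr_ge0 ?phi_ge0// mdist_ge0.
by move: delta0; lra.
Qed.

End warped_dist.

(** * Gromov boundaries *)

Lemma lee_real_lt (R : realType) (x y : \bar R) :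
  (forall t : R, (t%:E < x)%E -> (t%:E <= y)%E) -> (x <= y)%E.
Proof.
move=> H; rewrite leNgt; apply/negP => yx.
case: x y yx H => [x| |] [y| |] //= yx H.
- have := H ((x + y) / 2); rewrite lte_fin lee_fin; move: yx; rewrite lte_fin => yx.
  have xy : (x + y) / 2 < x by lra.
  by move=> /(_ xy); lra.
- by have := H (x - 1); rewrite lte_fin gtrBl ltr01 => /(_ isT); rewrite leeNy_eq.
- by have := H (y + 1) (ltry _); rewrite lee_fin gerDl ler10.
- by have := H 0 (ltry _); rewrite leeNy_eq.
Qed.

Section limf_einf.
Context (R : realType) (T : choiceType) (X : filteredType T) (F : set_system X).
Implicit Types (f : X -> R) (t : R).

Lemma near_lt_limf_einf f t : Filter F ->
  (t%:E < limf_einf (fun x => (f x)%:E) F)%E -> F [set x | t <= f x].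
Proof.
move=> FF; rewrite limf_einfE => /ereal_sup_gt[_ [V FV <-] tV].
apply: filterS FV => x Vx; rewrite /= -lee_fin (le_trans (ltW tV))//.
by apply: ereal_inf_lbound; exists x.
Qed.

Lemma limf_einf_ge f t : F [set x | t <= f x] ->
  (t%:E <= limf_einf (fun x => (f x)%:E) F)%E.
Proof.
move=> tf; rewrite limf_einfE; apply: le_trans (ereal_sup_ubound _); last first.
  by exists [set x | t <= f x]; first exact: tf.
by apply: le_ereal_inf_tmp => _ [x /= tx <-]; rewrite lee_fin.
Qed.

End limf_einf.

Lemma near_prod_ooP (P : nat * nat -> Prop) :
  (\forall ij \near filter_prod \oo \oo, P ij) <->
  exists N, forall i j, (N <= i)%N -> (N <= j)%N -> P (i, j).
Proof.
split=> [[[A B] /= [[n _ nA] [m _ mB]] AB]|[N HN]].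
  exists (maxn n m) => i j; rewrite !geq_max => /andP[ni _] /andP[_ mj].
  by apply: AB; split; [exact: nA|exact: mB].
exists ([set i | (N <= i)%N], [set j | (N <= j)%N]).
  by split; exists N.
by move=> [i j] [/= Ni Nj]; exact: HN.
Qed.

Lemma near_ooP (P : nat -> Prop) :
  (\forall i \near \oo, P i) <-> exists N, forall i, (N <= i)%N -> P i.
Proof.
by split=> [[N _ HN]|[N HN]]; exists N.
Qed.

(** * Gromov sequences and boundary points for a bare distance *)

Section gromov_class.
Context (R : realType) (T : Type) (d : T -> T -> R) (w : T).
Implicit Types x y : nat -> T.
Local Notation G := (gromov_prod d w).

Lemma gromov_seqP x : gromov_seq d w x <->
  forall M : R, exists N, forall i j, (N <= i)%N -> (N <= j)%N -> M <= G (x i) (x j).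
Proof.
rewrite /gromov_seq; split=> [/cvgryPge H M|H].
  by have /near_prod_ooP := H M.
by apply/cvgryPge => M; apply/near_prod_ooP; exact: H.
Qed.

Lemma gromov_equivP x y : gromov_equiv d w x y <->
  forall M : R, exists N, forall i, (N <= i)%N -> M <= G (x i) (y i).
Proof.
rewrite /gromov_equiv; split=> [/cvgryPge H M|H].
  by have /near_ooP := H M.
by apply/cvgryPge => M; apply/near_ooP; exact: H.
Qed.

Lemma gromov_seq_equiv x : gromov_seq d w x -> gromov_equiv d w x x.
Proof.
move=> /gromov_seqP H; apply/gromov_equivP => M.
by have [N HN] := H M; exists N => i Ni; exact: HN.
Qed.

Lemma gromov_class_of x : gromov_seq d w x ->
  gromov_class d w [set y | gromov_seq d w y /\ gromov_equiv d w x y].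
Proof. by exists x. Qed.

Definition boundary_point x (Gx : gromov_seq d w x) : gromov_boundary d w :=
  exist _ _ (gromov_class_of Gx).

Lemma boundary_rep (a : gromov_boundary d w) : exists x, sval a x.
Proof.
case: a => A [x Gx AE] /=; exists x; rewrite AE; split=> //.
exact: gromov_seq_equiv.
Qed.

Lemma boundary_gromov_seq (a : gromov_boundary d w) x : sval a x -> gromov_seq d w x.
Proof. by case: a => A [z Gz AE] /=; rewrite AE => -[]. Qed.

(** Symmetry and transitivity are abstract here because they have two sources: the metric and its
    hyperbolicity for [X], the description of sequences by components for the product. *)
Hypothesis equiv_sym : forall x y, gromov_equiv d w x y -> gromov_equiv d w y x.
Hypothesis equiv_trans : forall x y z, gromov_equiv d w x y ->
  gromov_equiv d w y z -> gromov_equiv d w x z.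

Lemma boundary_equiv (a : gromov_boundary d w) x y :
  sval a x -> sval a y -> gromov_equiv d w x y.
Proof.
case: a => A [z Gz AE] /=; rewrite AE => -[_ zx] [_ zy].
exact: equiv_trans (equiv_sym zx) zy.
Qed.

Lemma boundary_mem (a : gromov_boundary d w) x y :
  sval a x -> gromov_seq d w y -> gromov_equiv d w x y -> sval a y.
Proof.
case: a => A [z Gz AE] /=; rewrite AE => -[_ zx] Gy xy; split=> //.
exact: equiv_trans zx xy.
Qed.

Lemma boundary_eq (a b : gromov_boundary d w) x y :
  sval a x -> sval b y -> gromov_equiv d w x y -> a = b.
Proof.
move=> ax by_ xy.
have : sval a = sval b.
  apply/seteqP; split => z zin.
    apply: (boundary_mem by_ (boundary_gromov_seq zin)).
    exact: equiv_trans (equiv_sym xy) (boundary_equiv ax zin).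
  apply: (boundary_mem ax (boundary_gromov_seq zin)).
  exact: equiv_trans xy (boundary_equiv by_ zin).
case: a b {ax by_} => [A HA] [B HB] /= AB; subst B.
by congr exist; exact: Prop_irrelevance.
Qed.

End gromov_class.

Section hyperbolic_boundary.
Context (R : realType) (X : metricType R) (x0 : X) (delta : R).
Hypothesis hypX : gromov_hyperbolic (@mdist R X) delta.
Local Notation G := (gromov_prod (@mdist R X) x0).
Local Notation equiv := (gromov_equiv (@mdist R X) x0).

Lemma gromov_prodC (x y : X) : G x y = G y x.
Proof. by rewrite /gromov_prod [mdist x y]metric_sym [mdist x x0 + _]addrC. Qed.

Lemma gromov_equiv_sym (x y : nat -> X) : equiv x y -> equiv y x.
Proof.
move=> /gromov_equivP H; apply/gromov_equivP => M.
by have [N HN] := H M; exists N => i Ni; rewrite gromov_prodC HN.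
Qed.

Lemma gromov_equiv_trans (x y z : nat -> X) : equiv x y -> equiv y z -> equiv x z.
Proof.
move=> /gromov_equivP Hxy /gromov_equivP Hyz; apply/gromov_equivP => M.
have [N1 H1] := Hxy (M + delta); have [N2 H2] := Hyz (M + delta).
exists (maxn N1 N2) => i; rewrite geq_max => /andP[Ni1 Ni2].
rewrite -(lerD2r delta) (le_trans _ (hypX (x i) (z i) (y i) x0))//.
by rewrite le_min H1//= gromov_prodC H2.
Qed.

Lemma boundary_prod_ge0 (a b : gromov_boundary (@mdist R X) x0) :
  (0 <= boundary_prod a b)%E.
Proof.
apply: le_ereal_inf_tmp => _ [x ax [y by_ <-]].
by apply: limf_einf_ge; near=> ij; exact: gromov_prod_mdist_ge0.
Unshelve. all: by end_near. Qed.

(** [x i] and [y j] are compared through [x j], which has a large product with both. *)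
Lemma boundary_prodxx (a : gromov_boundary (@mdist R X) x0) :
  boundary_prod a a = +oo%E.
Proof.
apply/eqP; rewrite -leye_eq; apply: le_ereal_inf_tmp => _ [x ax [y ay <-]].
apply: lee_real_lt => t _; apply: limf_einf_ge; apply/near_prod_ooP.
have /gromov_seqP/(_ (t + delta))[N1 H1] := boundary_gromov_seq ax.
have /gromov_equivP/(_ (t + delta))[N2 H2] :=
  boundary_equiv gromov_equiv_sym gromov_equiv_trans ax ay.
exists (maxn N1 N2) => i j; rewrite !geq_max => /andP[Ni1 Ni2] /andP[Nj1 Nj2] /=.
rewrite -(lerD2r delta) (le_trans _ (hypX (x i) (y j) (x j) x0))//.
by rewrite le_min H1//= gromov_prodC H2.
Qed.

End hyperbolic_boundary.

(** Compactness gives a cluster point, and a cluster point of a Cauchy sequence is its limit. *)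
Lemma compact_cauchy_cvg (R : realType) (Y : metricType R) (y : nat -> Y) :
  compact [set: Y] ->
  (forall e : R, 0 < e -> exists N, forall i j, (N <= i)%N -> (N <= j)%N ->
    mdist (y i) (y j) < e) ->
  exists l, forall e : R, 0 < e -> exists N, forall i, (N <= i)%N -> mdist (y i) l < e.
Proof.
move=> cY yC; have [|l [_ cl]] := cY (y @ \oo) _; first exact: filterT.
exists l => e e0; have e2 : 0 < e / 2 by rewrite divr_gt0.
have [N HN] := yC _ e2; exists N => i Ni.
have [|z [[j /= Nj <-] jl]] := cl [set y j | j in [set j | (N <= j)%N]]
    (ball l (e / 2)) _ (nbhsx_ballx l _ e2).
  by exists N => // j /= Nj; exists j.
move: jl; rewrite ballEmdist /= metric_sym => jl.
rewrite (le_lt_trans (metric_triangle _ (y j) _))//.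
by have := HN i j Ni Nj; lra.
Qed.

(** * The boundary of the product *)

Section product_boundary.
Context (R : realType) (X Y : metricType R) (x0 : X) (y0 : Y) (delta K : R)
  (dZ : X * Y -> X * Y -> R) (psi : R -> \bar R).
Hypothesis hypX : gromov_hyperbolic (@mdist R X) delta.
Hypothesis cY : compact [set: Y].
Local Notation GX := (gromov_prod (@mdist R X) x0).
Local Notation GZ := (gromov_prod dZ (x0, y0)).
(** The next three hypotheses say that [GZ] is the minimum of [GX] and [psi] up to [K]; they are all
    that this section uses about [dZ]. *)
Hypothesis prod_le : forall z z' : X * Y, GZ z z' <= GX z.1 z'.1 + K.
Hypothesis prod_le_psi : forall z z' : X * Y,
  ((GZ z z')%:E <= psi (mdist z.2 z'.2) + K%:E)%E.
Hypothesis prod_ge : forall (z z' : X * Y) (t : R), 0 <= t -> t <= GX z.1 z'.1 ->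
  (t%:E <= psi (mdist z.2 z'.2))%E -> t <= GZ z z' + K.
Hypothesis psi0 : psi 0 = +oo%E.
Hypothesis psi_ge0 : forall r, 0 <= r -> (0 <= psi r)%E.
Hypothesis psi_lsc : forall t r : R, 0 <= r -> (t%:E < psi r)%E ->
  exists2 e, 0 < e & forall r', 0 <= r' -> r' < r + e -> (t%:E <= psi r')%E.
Hypothesis psi_small : forall e : R, 0 < e ->
  exists M : R, forall r, 0 <= r -> (M%:E <= psi r)%E -> r < e.

Local Notation bX := (gromov_boundary (@mdist R X) x0).
Local Notation bZ := (gromov_boundary dZ (x0, y0)).
Implicit Types (s : nat -> X * Y) (M : R).

Let pr1 s : nat -> X := fun i => (s i).1.

Let psi_tends M : exists2 e, 0 < e & forall r, 0 <= r -> r < e -> (M%:E <= psi r)%E.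
Proof.
have [|e e0 He] := @psi_lsc M 0 (lexx 0); first by rewrite psi0 ltry.
by exists e => // r r0 re; apply: He => //; rewrite add0r.
Qed.

(** This and [prod_large_inv] state uniformly that [GZ] is large exactly when [GX] is large and the
    [Y]-components are close. *)
Let prod_large M : exists M' e, 0 < e /\ forall z z' : X * Y, M' <= GX z.1 z'.1 ->
  mdist z.2 z'.2 < e -> M <= GZ z z'.
Proof.
pose M' := Num.max 0 (M + K).
have [e e0 He] := psi_tends M'.
exists M', e; split=> // z z' MG ze.
have M'0 : 0 <= M' by rewrite le_max lexx.
have := prod_ge M'0 MG (He _ (mdist_ge0 _ _) ze).
by move=> h; rewrite -(lerD2r K) (le_trans _ h)// le_max lexx orbT.
Qed.

Let prod_large_inv M e : 0 < e -> exists M', forall z z' : X * Y, M' <= GZ z z' ->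
  M <= GX z.1 z'.1 /\ mdist z.2 z'.2 < e.
Proof.
move=> /psi_small[M1 HM1]; exists (Num.max (M + K) (M1 + K)) => z z'.
rewrite ge_max => /andP[h1 h2]; split.
  by have := prod_le z z'; lra.
apply: HM1; first exact: mdist_ge0.
have := prod_le_psi z z'; rewrite -leeBlDr// -EFinB; apply: le_trans.
by rewrite lee_fin lerBrDr.
Qed.

Lemma product_gromov_seqP s : gromov_seq dZ (x0, y0) s <->
  gromov_seq (@mdist R X) x0 (pr1 s) /\
  forall e : R, 0 < e -> exists N, forall i j, (N <= i)%N -> (N <= j)%N ->
    mdist (s i).2 (s j).2 < e.
Proof.
split=> [/gromov_seqP H|[/gromov_seqP H1 H2]].
  split.
    apply/gromov_seqP => M; have [M' HM'] := prod_large_inv M ltr01.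
    by have [N HN] := H M'; exists N => i j Ni Nj; have [] := HM' _ _ (HN i j Ni Nj).
  move=> e e0; have [M' HM'] := prod_large_inv 0 e0.
  by have [N HN] := H M'; exists N => i j Ni Nj; have [] := HM' _ _ (HN i j Ni Nj).
apply/gromov_seqP => M; have [M' [e [e0 He]]] := prod_large M.
have [N1 HN1] := H1 M'; have [N2 HN2] := H2 e e0.
exists (maxn N1 N2) => i j; rewrite !geq_max => /andP[i1 i2] /andP[j1 j2].
by apply: He; [exact: HN1|exact: HN2].
Qed.

Lemma product_gromov_equivP s s' : gromov_equiv dZ (x0, y0) s s' <->
  gromov_equiv (@mdist R X) x0 (pr1 s) (pr1 s') /\
  forall e : R, 0 < e -> exists N, forall i, (N <= i)%N ->
    mdist (s i).2 (s' i).2 < e.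
Proof.
split=> [/gromov_equivP H|[/gromov_equivP H1 H2]].
  split.
    apply/gromov_equivP => M; have [M' HM'] := prod_large_inv M ltr01.
    by have [N HN] := H M'; exists N => i Ni; have [] := HM' _ _ (HN i Ni).
  move=> e e0; have [M' HM'] := prod_large_inv 0 e0.
  by have [N HN] := H M'; exists N => i Ni; have [] := HM' _ _ (HN i Ni).
apply/gromov_equivP => M; have [M' [e [e0 He]]] := prod_large M.
have [N1 HN1] := H1 M'; have [N2 HN2] := H2 e e0.
exists (maxn N1 N2) => i; rewrite !geq_max => /andP[i1 i2].
by apply: He; [exact: HN1|exact: HN2].
Qed.

Lemma product_equiv_sym s s' : gromov_equiv dZ (x0, y0) s s' ->
  gromov_equiv dZ (x0, y0) s' s.
Proof.
move=> /product_gromov_equivP[H1 H2]; apply/product_gromov_equivP; split.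
  exact: gromov_equiv_sym.
by move=> e /H2[N HN]; exists N => i /HN; rewrite metric_sym.
Qed.

Lemma product_equiv_trans s1 s2 s3 : gromov_equiv dZ (x0, y0) s1 s2 ->
  gromov_equiv dZ (x0, y0) s2 s3 -> gromov_equiv dZ (x0, y0) s1 s3.
Proof.
move=> /product_gromov_equivP[H1 H2] /product_gromov_equivP[H1' H2'].
apply/product_gromov_equivP; split; first exact: (gromov_equiv_trans hypX H1).
move=> e e0; have e2 : 0 < e / 2 by rewrite divr_gt0.
have [N1 HN1] := H2 _ e2; have [N2 HN2] := H2' _ e2.
exists (maxn N1 N2) => i; rewrite geq_max => /andP[/HN1 h1 /HN2 h2].
by rewrite (le_lt_trans (metric_triangle _ (s2 i).2 _))//; lra.
Qed.

(** This relation is the graph of the desired bijection. Quantifying over all representatives of [z]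
    lets the limit in [Y] be used for any of them. *)
Definition represents (z : bZ) (p : bX * Y) : Prop :=
  forall s, sval z s -> sval p.1 (pr1 s) /\
    forall e : R, 0 < e -> exists N, forall i, (N <= i)%N -> mdist (s i).2 p.2 < e.

Lemma exists_represents (z : bZ) : exists p, represents z p.
Proof.
have [s zs] := boundary_rep z.
have /product_gromov_seqP[G1 C2] := boundary_gromov_seq zs.
have [l Hl] := compact_cauchy_cvg cY C2.
exists (boundary_point G1, l) => s' zs'.
have /product_gromov_equivP[E1 E2] :=
  boundary_equiv product_equiv_sym product_equiv_trans zs zs'.
have /product_gromov_seqP[G1' _] := boundary_gromov_seq zs'.
split=> //= e e0; have e2 : 0 < e / 2 by rewrite divr_gt0.
have [N1 HN1] := Hl _ e2; have [N2 HN2] := E2 _ e2.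
exists (maxn N1 N2) => i; rewrite geq_max => /andP[/HN1 h1 /HN2 h2].
by rewrite (le_lt_trans (metric_triangle _ (s i).2 _))// metric_sym; lra.
Qed.

(** Representatives with constant second component make the upper bounds on boundary products
    direct: the distance in [Y] is then exactly [mdist p.2 p'.2]. *)
Lemma represents_mem (z : bZ) (p : bX * Y) (x : nat -> X) :
  represents z p -> sval p.1 x -> sval z (fun i => (x i, p.2)).
Proof.
move=> zp px; have [s zs] := boundary_rep z.
have [ps lims] := zp s zs.
apply: (boundary_mem product_equiv_trans zs).
  apply/product_gromov_seqP; split; first exact: boundary_gromov_seq px.
  by move=> e e0; exists 0%N => i j _ _; rewrite mdistxx.
apply/product_gromov_equivP; split=> //.
exact: (boundary_equiv (@gromov_equiv_sym _ _ _) (gromov_equiv_trans hypX) ps px).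
Qed.

Lemma represents_inj (z z' : bZ) p : represents z p -> represents z' p -> z = z'.
Proof.
move=> zp zp'; have [x px] := boundary_rep p.1.
have zx := represents_mem zp px; have zx' := represents_mem zp' px.
apply: (boundary_eq product_equiv_sym product_equiv_trans zx zx').
exact: gromov_seq_equiv (boundary_gromov_seq zx).
Qed.

Lemma represents_surj (p : bX * Y) : exists z, represents z p.
Proof.
have [x px] := boundary_rep p.1.
have Gx : gromov_seq dZ (x0, y0) (fun i => (x i, p.2)).
  apply/product_gromov_seqP; split; first exact: boundary_gromov_seq px.
  by move=> e e0; exists 0%N => i j _ _; rewrite mdistxx.
exists (boundary_point Gx) => s [Gs /product_gromov_equivP[E1 E2]]; split.
  have /product_gromov_seqP[G1 _] := Gs.
  exact: (boundary_mem (gromov_equiv_trans hypX) px G1 E1).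
by move=> e /E2[N HN]; exists N => i /HN; rewrite metric_sym.
Qed.

Lemma represents_uniq z (p p' : bX * Y) : represents z p -> represents z p' -> p = p'.
Proof.
move=> zp zp'; have [s zs] := boundary_rep z.
have [p1 p2] := zp s zs; have [p1' p2'] := zp' s zs.
case: p p' zp zp' p1 p2 p1' p2' => [a y] [a' y'] _ _ /= p1 p2 p1' p2'.
congr (_, _).
  apply: (boundary_eq (@gromov_equiv_sym _ _ _) (gromov_equiv_trans hypX) p1 p1').
  exact: gromov_seq_equiv (boundary_gromov_seq p1).
apply: contrapT => /eqP; rewrite -mdist_gt0 => d0.
have d2 : 0 < mdist y y' / 2 by rewrite divr_gt0.
have [N1 H1] := p2 _ d2; have [N2 H2] := p2' _ d2.
have := H1 _ (leq_maxl N1 N2); have := H2 _ (leq_maxr N1 N2).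
have := metric_triangle y (s (maxn N1 N2)).2 y'.
by rewrite [mdist y (s _).2]metric_sym; lra.
Qed.

Local Notation BX := (@boundary_prod R X (@mdist R X) x0).
Local Notation BZ := (@boundary_prod R (X * Y)%type dZ (x0, y0)).

Lemma boundary_prod_le z z' p p' : represents z p -> represents z' p' ->
  (BZ z z' <= BX p.1 p'.1 + K%:E)%E.
Proof.
move=> zp zp'; rewrite -leeBlDr//; apply: le_ereal_inf_tmp => _ [x px [x' px' <-]].
rewrite leeBlDr//; apply: lee_real_lt => t tB.
have : (t%:E < limf_einf (fun ij : nat * nat => (GZ (x ij.1, p.2) (x' ij.2, p'.2))%:E)
    (filter_prod \oo \oo))%E.
  apply: lt_le_trans tB _; apply: ereal_inf_lbound.
  exists (fun i => (x i, p.2)); first exact: represents_mem zp px.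
  by exists (fun i => (x' i, p'.2)); first exact: represents_mem zp' px'.
move=> /near_lt_limf_einf near_t.
rewrite -leeBlDr// -EFinB; apply: limf_einf_ge.
apply: filterS near_t => -[i j] /=.
have /= := prod_le (x i, p.2) (x' j, p'.2); lra.
Qed.

Lemma boundary_prod_le_psi z z' p p' : represents z p -> represents z' p' ->
  (BZ z z' <= psi (mdist p.2 p'.2) + K%:E)%E.
Proof.
move=> zp zp'; have [x px] := boundary_rep p.1; have [x' px'] := boundary_rep p'.1.
apply: lee_real_lt => t tB.
have : (t%:E < limf_einf (fun ij : nat * nat => (GZ (x ij.1, p.2) (x' ij.2, p'.2))%:E)
    (filter_prod \oo \oo))%E.
  apply: lt_le_trans tB _; apply: ereal_inf_lbound.
  exists (fun i => (x i, p.2)); first exact: represents_mem zp px.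
  by exists (fun i => (x' i, p'.2)); first exact: represents_mem zp' px'.
move=> /near_lt_limf_einf/near_prod_ooP[N HN].
(* The second components are constant, so a single index suffices. *)
apply: le_trans (prod_le_psi (x N, p.2) (x' N, p'.2)).
by rewrite lee_fin; exact: HN.
Qed.

(** All representatives must be treated, with second components that merely converge; lower
    semicontinuity of [psi] handles them. *)
Lemma boundary_prod_ge z z' p p' t : represents z p -> represents z' p' ->
  0 <= t -> (t%:E <= BX p.1 p'.1)%E -> (t%:E <= psi (mdist p.2 p'.2))%E ->
  (t%:E <= BZ z z' + K%:E)%E.
Proof.
move=> zp zp' t0 tX tpsi.
(* A bound by [u < t] holds eventually along the sequences, one by [t] itself need not; [u = 0] is
   kept apart to cover [t = 0]. *)
have key u : 0 <= u -> u = 0 \/ u < t -> (u%:E <= BZ z z' + K%:E)%E.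
  move=> u0 ut; rewrite -leeBlDr// -EFinB.
  apply: le_ereal_inf_tmp => _ [s zs [s' zs' <-]]; apply: limf_einf_ge.
  have [ps lims] := zp s zs; have [ps' lims'] := zp' s' zs'.
  have uX : \forall ij \near filter_prod \oo \oo, u <= GX (s ij.1).1 (s' ij.2).1.
    case: ut => [->|ut]; first by near=> ij; exact: gromov_prod_mdist_ge0.
    apply: near_lt_limf_einf; apply: (@lt_le_trans _ _ t%:E); first by rewrite lte_fin.
    apply: (le_trans tX); apply: ereal_inf_lbound.
    by exists (pr1 s) => //; exists (pr1 s').
  have upsi : \forall ij \near filter_prod \oo \oo,
      (u%:E <= psi (mdist (s ij.1).2 (s' ij.2).2))%E.
    case: ut => [->|ut]; first by near=> ij; exact: psi_ge0 (mdist_ge0 _ _).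
    have up : (u%:E < psi (mdist p.2 p'.2))%E.
      by apply: lt_le_trans tpsi; rewrite lte_fin.
    have [e e0 He] := psi_lsc (mdist_ge0 _ _) up.
    have e2 : 0 < e / 2 by rewrite divr_gt0.
    have [N1 HN1] := lims _ e2; have [N2 HN2] := lims' _ e2.
    apply/near_prod_ooP; exists (maxn N1 N2) => i j.
    rewrite !geq_max => /andP[/HN1 h1 _] /andP[_ /HN2 h2] /=.
    apply: He; first exact: mdist_ge0.
    have := metric_triangle (s i).2 p.2 (s' j).2.
    have := metric_triangle p.2 p'.2 (s' j).2.
    by rewrite [mdist p'.2 _]metric_sym; lra.
  apply: filterS2 uX upsi => -[i j] /= h1 h2.
  by rewrite lerBlDr; exact: prod_ge.
apply: lee_real_lt => u; rewrite lte_fin => ut.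
have [u0|u0] := leP 0 u; first by apply: key => //; right.
by apply: (@le_trans _ _ 0%E); [rewrite lee_fin ltW|apply: key => //; left].
Unshelve. all: by end_near. Qed.

End product_boundary.

(** * Visual metrics *)

Section expN.
Context (R : realType) (eps : R).
Hypothesis eps0 : 0 < eps.
Implicit Types (g : \bar R).

Lemma expN_fin (r : R) : expN eps r%:E = expR (- (eps * r)).
Proof. by rewrite /expN -EFinM -EFinN. Qed.

Lemma expNy : expN eps +oo%E = 0.
Proof. by rewrite /expN gt0_muley ?lte_fin. Qed.

Lemma expN_ge0 g : 0 <= expN eps g.
Proof. by rewrite /expN fine_ge0// expeR_ge0. Qed.

(** An additive error in the exponent becomes a factor. The value [-oo] of [g] is excluded because
    its exponential [+oo] is sent to 0 by [fine]. *)
Lemma expN_le_addr g g' (K : R) : g != -oo%E -> (g <= g' + K%:E)%E ->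
  expN eps g' <= expR (eps * K) * expN eps g.
Proof.
case: g g' => [r| |] [r'| |] //= _.
- rewrite !expN_fin -expRD ler_expR -EFinD lee_fin => h.
  by rewrite -mulrN -mulrN -mulrDr ler_pM2l//; lra.
- by rewrite expNy => _; rewrite mulr_ge0 ?expR_ge0 ?expN_ge0.
- by rewrite expNy mulr0.
Qed.

Lemma expN_small (e : R) : 0 < e ->
  exists M : R, forall g, (M%:E <= g)%E -> expN eps g < e.
Proof.
move=> e0; have e2 : 0 < e / 2 by rewrite divr_gt0.
exists (- (ln (e / 2) / eps)) => -[r| |] //=; last by rewrite expNy.
rewrite lee_fin => h; rewrite expN_fin.
apply: (@le_lt_trans _ _ (e / 2)); last by lra.
rewrite -[leRHS]lnK ?posrE// ler_expR lerNl.
by rewrite -ler_pdivrMl// mulrC mulNr.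
Qed.

Lemma expN_small_inv (M : R) :
  exists2 e : R, 0 < e & forall g, (0 <= g)%E -> expN eps g < e -> (M%:E <= g)%E.
Proof.
exists (expR (- (eps * M))); first exact: expR_gt0.
case=> [r| |] //= _; last by rewrite leey.
by rewrite expN_fin ltr_expR ltrN2 ltr_pM2l// lee_fin => /ltW.
Qed.

End expN.

Section visual_dist.
Context (R : realType) (T : Type) (d : T -> T -> R) (w : T) (eps : R).
Local Notation bT := (gromov_boundary d w).
Local Notation rho a b := (expN eps (boundary_prod a b)).
Local Notation vd := (@visual_dist R T d w eps).
Implicit Types a b c : bT.

Lemma visual_dist_le_chain k (x : nat -> bT) :
  vd (x 0%N) (x k.+1) <= \sum_(i < k.+1) rho (x i) (x i.+1).
Proof.
apply: ge_inf; last by exists k, x.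
by exists 0 => _ [n [y [_ _ ->]]]; apply: sumr_ge0 => i _; exact: expN_ge0.
Qed.

Lemma visual_dist_ge a b r :
  (forall k (x : nat -> bT), x 0%N = a -> x k.+1 = b ->
    r <= \sum_(i < k.+1) rho (x i) (x i.+1)) -> r <= vd a b.
Proof.
move=> H; apply: lb_le_inf.
  exists (rho a b), 0%N, (fun i => if i is 0%N then a else b); split=> //.
  by rewrite big_ord1.
by move=> _ [k [x [x0 xk ->]]]; exact: H.
Qed.

Lemma visual_dist_le a b : vd a b <= rho a b.
Proof.
have := @visual_dist_le_chain 0%N (fun i => if i is 0%N then a else b).
by rewrite big_ord1.
Qed.

Lemma visual_dist_ge0 a b : 0 <= vd a b.
Proof.
apply: visual_dist_ge => k x _ _; apply: sumr_ge0 => i _; exact: expN_ge0.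
Qed.

Lemma visual_dist_triangle a b c : vd a c <= vd a b + vd b c.
Proof.
rewrite -lerBlDr; apply: visual_dist_ge => k x xa xb.
rewrite lerBlDl -lerBlDr; apply: visual_dist_ge => l y yb yc.
rewrite lerBlDl.
(* Concatenation of the chains: [x k.+1] and [y 0] are the same point, which is listed once, as
   [z k.+1]. *)
pose z i := if (i <= k)%N then x i else y (i - k.+1)%N.
have -> : a = z 0%N by rewrite /z /= xa.
have -> : c = z (k.+1 + l).+1 by rewrite /z -addnS -yc ifF ?addKn//; lia.
apply: (le_trans (visual_dist_le_chain _ _)).
rewrite -addnS big_split_ord/=; apply: lerD.
  apply: ler_sum => i _; rewrite /z -ltnS ltn_ord.
  have [ik|ki] //= := ltnP i k.
  have -> : (i : nat) = k by apply/eqP; rewrite eqn_leq ki -ltnS ltn_ord.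
  by rewrite subnn xb yb.
apply: ler_sum => i _; rewrite /z.
rewrite ifF; last by lia.
rewrite ifF; last by lia.
by rewrite -addnS !addKn.
Qed.

End visual_dist.

Section dist_space.
Context (R : realType) (T : Type) (d : T -> T -> R).
Hypothesis dxx : forall x, d x x = 0.
Hypothesis d_triangle : forall x y z, d x z <= d x y + d y z.

(** The triangle inequality makes the balls open, so they form neighbourhood bases. *)
Lemma nbhs_dist_spaceP (x : dist_space d) (A : set (dist_space d)) :
  nbhs x A <-> exists2 e : R, 0 < e & [set y : T | d x y < e] `<=` A.
Proof.
split=> [|[e e0 eA]].
  rewrite nbhsE => -[B [oB Bx] BA].
  have [e e0 eB] := oB x Bx.
  by exists e => //; apply: subset_trans BA.
rewrite nbhsE; exists [set y : T | d x y < e] => //; split; last by rewrite /= dxx.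
move=> y /= xy; exists (e - d x y); first by rewrite subr_gt0.
by move=> z /= yz; rewrite (le_lt_trans (d_triangle _ y _))// -ltrBrDl.
Qed.

End dist_space.

(** * Semicontinuity of [psi] and subadditivity of its exponential *)

Section warping_eta.
Context (R : realType) (alpha : R) (phi dphi : R -> R) (eps : R).
Hypothesis alpha0 : 0 < alpha.
Hypothesis phi1 : forall t : R, 0 <= t -> 1 <= phi t.
Hypothesis phiC1 : C1_halfline phi dphi.
Hypothesis phi_growth : forall t : R, 0 <= t -> alpha * phi t <= dphi t.
Hypothesis eps0 : 0 < eps.
Hypothesis eps_alpha : eps <= alpha.
Local Notation psi := (warping_psi alpha phi).
Local Notation eta r := (expN eps (psi r)).

Let phi_gt0 (t : R) : 0 <= t -> 0 < phi t.
Proof. by move=> t0; rewrite (lt_le_trans ltr01)// phi1. Qed.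

Lemma warping_psi_lsc t r : 0 <= r -> (t%:E < psi r)%E ->
  exists2 e, 0 < e & forall r', 0 <= r' -> r' < r + e -> (t%:E <= psi r')%E.
Proof.
move=> r0 tr; have [t0|t0] := leP 0 t; last first.
  exists 1 => // r' r'0 _; apply: (@le_trans _ _ 0%E); first by rewrite lee_fin ltW.
  exact: (warping_psi_ge0 alpha0 phi1 phiC1 phi_growth).
have lt2 := lt_warping_psi alpha0 phi1 phiC1 phi_growth r0 t0 tr.
have pa0 : 0 < phi t * alpha by rewrite mulr_gt0// phi_gt0.
(* For [t >= 0], the inequality [t <= psi r'] holds as soon as [r' <= 2 / (phi t * alpha)]. *)
exists (2 / (phi t * alpha) - r) => [|r' r'0].
  by rewrite subr_gt0 ltr_pdivlMr// mulrC -mulrA.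
rewrite addrC subrK ltr_pdivlMr// mulrC -mulrA => /ltW.
exact: (le_warping_psi alpha0 phi1 phiC1 phi_growth).
Qed.

Lemma warping_psi_small e : 0 < e ->
  exists M : R, forall r, 0 <= r -> (M%:E <= psi r)%E -> r < e.
Proof.
move=> e0; have [p [pE p0 _]] := warping_psi_gt0 alpha0 phi1 phiC1 phi_growth e0.
exists (p + 1) => r r0 h; rewrite ltNge; apply/negP => er.
have lt2 : phi p * (alpha * r) < 2.
  apply: (lt_warping_psi alpha0 phi1 phiC1 phi_growth) => //.
  by apply: lt_le_trans h; rewrite lte_fin ltrDl.
(* [p + 1/2] is strictly below [psi r], and semicontinuity extends this bound to all arguments below
   [r + e'], in particular to [e], where [psi e = p]. *)
have [|e' e'0 He'] := @warping_psi_lsc (p + 2^-1) r r0.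
  by apply: lt_le_trans h; rewrite lte_fin; lra.
have : ((p + 2^-1)%:E <= psi e)%E.
  by apply: He'; [exact: ltW|rewrite (le_lt_trans er)// ltrDl].
by rewrite pE lee_fin; lra.
Qed.

Lemma warping_psi_anti r s : 0 <= r -> r <= s -> (psi s <= psi r)%E.
Proof.
move=> r0 rs; apply: lee_real_lt => t ts.
have [e e0 He] := warping_psi_lsc (le_trans r0 rs) ts.
by apply: He => //; rewrite (le_lt_trans rs)// ltrDl.
Qed.

Lemma expN_psi0 : eta 0 = 0.
Proof. by rewrite warping_psi0 expNy. Qed.

Lemma expN_psi_le r s : 0 <= r -> r <= s -> eta r <= eta s.
Proof.
move=> r0 rs; have := @expN_le_addr _ _ eps0 (psi s) (psi r) 0.
rewrite mulr0 expR0 mul1r adde0; apply; last exact: warping_psi_anti.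
apply/eqP => sE; have := warping_psi_ge0 alpha0 phi1 phiC1 phi_growth (le_trans r0 rs).
by rewrite sE.
Qed.

(** The loss [ln k / alpha] in [psi] becomes the factor [k] to the power [eps / alpha], at most [k]
    because [eps <= alpha] and [k >= 1]. *)
Lemma expN_psi_scale k r : 0 < r -> 1 <= k -> eta (k * r) <= k * eta r.
Proof.
move=> r0 k1; have k0 : 0 < k by rewrite (lt_le_trans ltr01).
have := warping_psi_log alpha0 phi1 phiC1 phi_growth r0 k1.
have [p [pE _ _]] := warping_psi_gt0 alpha0 phi1 phiC1 phi_growth r0.
move=> /(expN_le_addr eps0); rewrite pE => /(_ isT) /le_trans; apply.
rewrite ler_wpM2r ?expN_ge0// -[leRHS]lnK ?posrE// ler_expR.
by rewrite mulrCA ler_piMr ?ln_ge0// ler_pdivrMr// mul1r.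
Qed.

(* [eta r / r] is nonincreasing, as [eps <= alpha]; so [eta] is subadditive. *)
Lemma expN_psi_add r s : 0 <= r -> 0 <= s -> eta (r + s) <= eta r + eta s.
Proof.
rewrite le_eqVlt => /predU1P[<- _|r0]; first by rewrite expN_psi0 !add0r.
rewrite le_eqVlt => /predU1P[<-|s0]; first by rewrite expN_psi0 !addr0.
have rs0 : 0 < r + s by rewrite addr_gt0.
have h1 : r * eta (r + s) <= (r + s) * eta r.
  have := @expN_psi_scale ((r + s) / r) r r0.
  rewrite divfK ?gt_eqF// ler_pdivlMr// mul1r lerDl => /(_ (ltW s0)).
  move=> /(ler_wpM2l (ltW r0)); set a := eta r; set b := eta (r + s).
  by have -> : r * ((r + s) / r * a) = (r + s) * a by field; rewrite gt_eqF.
have h2 : s * eta (r + s) <= (r + s) * eta s.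
  have := @expN_psi_scale ((r + s) / s) s s0.
  rewrite divfK ?gt_eqF// ler_pdivlMr// mul1r lerDr => /(_ (ltW r0)).
  move=> /(ler_wpM2l (ltW s0)); set a := eta s; set b := eta (r + s).
  by have -> : s * ((r + s) / s * a) = (r + s) * a by field; rewrite gt_eqF.
rewrite -(ler_pM2l rs0); move: h1 h2.
set a := eta (r + s); set b := eta r; set c := eta s.
by rewrite mulrDr mulrDl; lra.
Qed.

Lemma expN_psi_chain (Y : metricType R) k (y : nat -> Y) :
  eta (mdist (y 0%N) (y k)) <= \sum_(i < k) eta (mdist (y i) (y i.+1)).
Proof.
elim: k => [|k IH]; first by rewrite big_ord0 mdistxx expN_psi0.
have yk := metric_triangle (y 0%N) (y k) (y k.+1).
rewrite big_ord_recr/= (le_trans (expN_psi_le (mdist_ge0 _ _) yk))//.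
by rewrite (le_trans (expN_psi_add (mdist_ge0 _ _) (mdist_ge0 _ _)))// lerD2r.
Qed.

End warping_eta.

(** * Comparison of visual metrics along chains *)

Section boundary_comparison.
Context (R : realType) (X Y : metricType R) (x0 : X) (y0 : Y)
  (dZ : X * Y -> X * Y -> R) (eps : R) (eta : R -> R) (E : R).
Local Notation bX := (gromov_boundary (@mdist R X) x0).
Local Notation bZ := (gromov_boundary dZ (x0, y0)).
Local Notation rhoX a b := (expN eps (boundary_prod (a : bX) b)).
Local Notation rhoZ a b := (expN eps (boundary_prod (a : bZ) b)).
Local Notation vX := (@visual_dist R X (@mdist R X) x0 eps).
Local Notation vZ := (@visual_dist R (X * Y)%type dZ (x0, y0) eps).
Variables (Phi : bZ -> bX * Y) (Psi : bX * Y -> bZ).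
Hypothesis PhiK : cancel Phi Psi.
Hypothesis PsiK : cancel Psi Phi.
Hypothesis E0 : 0 < E.
Hypothesis eta0 : eta 0 = 0.
Hypothesis eta_chain : forall k (y : nat -> Y),
  eta (mdist (y 0%N) (y k)) <= \sum_(i < k) eta (mdist (y i) (y i.+1)).
Hypothesis rhoX_le : forall z z', rhoX (Phi z).1 (Phi z').1 <= E * rhoZ z z'.
Hypothesis eta_le : forall z z', eta (mdist (Phi z).2 (Phi z').2) <= E * rhoZ z z'.
Hypothesis rhoZ_le : forall z z',
  rhoZ z z' <= E * (rhoX (Phi z).1 (Phi z').1 + eta (mdist (Phi z).2 (Phi z').2)).

Lemma visual_dist_upper z z' :
  vZ z z' <= E * (vX (Phi z).1 (Phi z').1 + eta (mdist (Phi z).2 (Phi z').2)).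
Proof.
rewrite -ler_pdivrMl// -lerBlDr; apply: visual_dist_ge => k x xa xb.
rewrite lerBlDr ler_pdivrMl//.
(* The first step of the lifted chain makes the whole move in [Y]. *)
pose y i := if i is 0%N then (Phi z).2 else (Phi z').2.
pose c i := Psi (x i, y i).
have zE : z = c 0%N by rewrite /c xa -surjective_pairing PhiK.
have z'E : z' = c k.+1 by rewrite /c xb -surjective_pairing PhiK.
rewrite {1}zE {1}z'E (le_trans (visual_dist_le_chain _ _ _))//.
apply: (@le_trans _ _ (\sum_(i < k.+1) E *
    (rhoX (x i) (x i.+1) + eta (mdist (y i) (y i.+1))))).
  by apply: ler_sum => i _; have := rhoZ_le (c i) (c i.+1); rewrite !PsiK.
rewrite -mulr_sumr ler_pM2l// big_split/= lerD2l big_ord_recl/= big1 ?addr0//.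
by move=> i _; rewrite mdistxx eta0.
Qed.

(** A chain in the boundary of [Z] projects to a chain in each factor; either projection costs a
    factor [E], hence [2 * E] for the sum. *)
Lemma visual_dist_lower z z' :
  vX (Phi z).1 (Phi z').1 + eta (mdist (Phi z).2 (Phi z').2) <= 2 * E * vZ z z'.
Proof.
rewrite -ler_pdivrMl ?mulr_gt0//; apply: visual_dist_ge => k c ca cb.
rewrite ler_pdivrMl ?mulr_gt0// -ca -cb.
rewrite (_ : 2 * E * _ = E * \sum_(i < k.+1) rhoZ (c i) (c i.+1) +
  E * \sum_(i < k.+1) rhoZ (c i) (c i.+1)); last by rewrite -mulrA mulr_natl mulr2n.
rewrite mulr_sumr lerD//.
  apply: (le_trans (visual_dist_le_chain eps k (fun i => (Phi (c i)).1))).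
  by apply: ler_sum => i _; exact: rhoX_le.
apply: (le_trans (eta_chain k.+1 (fun i => (Phi (c i)).2))).
by apply: ler_sum => i _; exact: eta_le.
Qed.

Hypothesis eta_small : forall e, 0 < e ->
  exists2 e', 0 < e' & forall r, 0 <= r -> r < e' -> eta r < e.
Hypothesis eta_small_inv : forall e, 0 < e ->
  exists2 e', 0 < e' & forall r, 0 <= r -> eta r < e' -> r < e.
Hypothesis eta_ge0 : forall r, 0 <= eta r.
Hypothesis vXxx : forall a, vX a a = 0.

(** The two-sided bound on [vZ] gives both continuities, since [eta r] is small exactly when [r]
    is. *)
Lemma visual_homeomorphism :
  homeomorphism (Phi : visual_boundary dZ (x0, y0) eps ->
    (visual_boundary (@mdist R X) x0 eps * Y)%type).
Proof.
have vZxx z : vZ z z = 0.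
  apply/eqP; rewrite eq_le visual_dist_ge0 andbT.
  by rewrite (le_trans (visual_dist_upper z z))// mdistxx eta0 vXxx addr0 mulr0.
have E2 : 0 < 2 * E by rewrite mulr_gt0.
have nbhsX a A := @nbhs_dist_spaceP R _ vX vXxx (@visual_dist_triangle _ _ _ _ _) a A.
have nbhsZ z A := @nbhs_dist_spaceP R _ vZ vZxx (@visual_dist_triangle _ _ _ _ _) z A.
split.
  move=> z U [[A B] /= [/nbhsX[e1 e10 eA]
    /metricType_numDomainType.nbhs_mdistP[e2 /= e20 eB]] AB].
  have [e3 e30 He3] := eta_small_inv e20.
  apply/nbhsZ; exists (Num.min e1 e3 / (2 * E)).
    by rewrite divr_gt0// lt_min e10.
  move=> z' /=; rewrite ltr_pdivlMr// mulrC lt_min => /andP[h1 h3].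
  have h := visual_dist_lower z z'.
  apply: AB; split => /=.
    apply: eA => /=; apply: le_lt_trans h1; apply: le_trans h.
    by rewrite lerDl.
  apply: eB => /=; apply: He3; first exact: mdist_ge0.
  apply: le_lt_trans h3; apply: le_trans h.
  by rewrite lerDr visual_dist_ge0.
exists Psi; split=> //.
move=> p U /nbhsZ[e e0 eU].
(* The upper bound on [vZ] has two summands, each allowed half of [e / E]. *)
have eE : 0 < e / (2 * E) by rewrite divr_gt0.
have [e2 e20 He2] := eta_small eE.
exists ([set a | vX p.1 a < e / (2 * E)], [set y | mdist p.2 y < e2]) => /=.
  split; first by apply/nbhsX; exists (e / (2 * E)).
  by apply/metricType_numDomainType.nbhs_mdistP; exists e2.
move=> [a y] /= [ha /(He2 _ (mdist_ge0 _ _)) hy]; apply: eU => /=.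
apply: (le_lt_trans (visual_dist_upper _ _)); rewrite !PsiK /=.
rewrite mulrC -ltr_pdivlMr//.
have -> : e / E = e / (2 * E) + e / (2 * E) by field; rewrite gt_eqF.
exact: ltrD.
Qed.

End boundary_comparison.

(** * The boundary of the warped product *)

Theorem theorem1p2 (R : realType) :
  exists C : R -> R -> R -> R -> \bar R -> R,
    (forall alpha delta D p q, 1 <= C alpha delta D p q) /\
    forall (X Y : metricType R) (x0 : X) (y0 : Y) (delta alpha : R)
        (phi dphi : R -> R),
      complete_space X -> geodesic_space X ->
      0 <= delta -> gromov_hyperbolic (@mdist R X) delta ->
      compact [set: Y] -> geodesic_space Y ->
      0 < alpha ->
      (forall t, 0 <= t -> 1 <= phi t) ->
      C1_halfline phi dphi ->
      (forall t, 0 <= t -> alpha * phi t <= dphi t) ->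
      (forall s t, 0 <= s -> s < t -> dphi s < dphi t) ->
      let dZ : X * Y -> X * Y -> R := warped_dist x0 phi in
      let z0 : X * Y := (x0, y0) in
      let delta_phi := alpha^-1 + 44 * delta + 3 / 2 * phi 0 * diam Y in
      exists Phi : gromov_boundary dZ z0 ->
                   gromov_boundary (@mdist R X) x0 * Y,
        bijective Phi /\
        forall eps : R, 0 < eps -> eps <= ln 2 / delta_phi ->
          homeomorphism
            (Phi : visual_boundary dZ z0 eps ->
                   (visual_boundary (@mdist R X) x0 eps * Y)%type) /\
          forall z z' : gromov_boundary dZ z0,
            comparable_with
              (C alpha delta (diam Y) (phi 0)
                 (phi_inv phi (dphi 0 / alpha)%:E))
              (visual_dist eps z z')
              (visual_dist eps (Phi z).1 (Phi z').1 +
               expN eps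
                 (phi_inv phi
                    (2%:E / (alpha * mdist (Phi z).2 (Phi z').2)%:E)%E)).
Proof.
(* The exponent is [alpha * K], with [K] the additive error in the Gromov products; [eps <= alpha]
   makes it dominate [eps * K]. The factor 2 comes from [visual_dist_lower], and the absolute value
   gives [1 <= C] for arbitrary arguments. *)
exists (fun alpha delta D p _ => 2 * expR `|alpha * (delta + alpha^-1 + p * D)|).
split=> [alpha delta D p _|].
  by have := expR_ge1Dx `|alpha * (delta + alpha^-1 + p * D)|;
     have := normr_ge0 (alpha * (delta + alpha^-1 + p * D)); lra.
move=> X Y x0 y0 delta alpha phi dphi _ geoX delta0 hypX cY geoY alpha0 phi1
  phiC1 growth _ dZ z0 delta_phi.
pose K := delta + alpha^-1 + phi 0 * diam Y.
pose psi := warping_psi alpha phi.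
have ai0 : 0 < alpha^-1 by rewrite invr_gt0.
have phi00 : 0 <= phi 0 by rewrite (le_trans ler01)// phi1.
have D0 : 0 <= diam Y.
  by rewrite (le_trans (mdist_ge0 y0 y0))//; exact: compact_mdist_le_diam.
have PD0 : 0 <= phi 0 * diam Y by rewrite mulr_ge0.
have prod_le (z z' : X * Y) : gromov_prod dZ z0 z z' <=
    gromov_prod (@mdist R X) x0 z.1 z'.1 + K.
  case: z z' => [x y] [x' y'] /=.
  apply: (le_trans (warped_prod_le x0 y0 geoX cY geoY phi1 x y x' y')).
  by rewrite lerD2l /K; move: delta0 ai0; lra.
have prod_le_psi (z z' : X * Y) : ((gromov_prod dZ z0 z z')%:E <=
    psi (mdist z.2 z'.2) + K%:E)%E.
  case: z z' => [x y] [x' y'] /=.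
  apply: (le_trans (warped_prod_le_psi x0 y0 geoX cY geoY alpha0 phi1 phiC1
    growth x y x' y')).
  by rewrite leeD2l// lee_fin /K; move: delta0 ai0; lra.
have prod_ge (z z' : X * Y) t : 0 <= t -> t <= gromov_prod (@mdist R X) x0 z.1 z'.1 ->
    (t%:E <= psi (mdist z.2 z'.2))%E -> t <= gromov_prod dZ z0 z z' + K.
  case: z z' => [x y] [x' y'] /=.
  exact: (warped_prod_ge y0 geoX delta0 hypX cY geoY alpha0 phi1 phiC1 growth).
have psi0 : psi 0 = +oo%E by exact: warping_psi0.
have psi_ge0 := warping_psi_ge0 alpha0 phi1 phiC1 growth.
have psi_lsc := warping_psi_lsc alpha0 phi1 phiC1 growth.
have psi_small := warping_psi_small alpha0 phi1 phiC1 growth.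
(* [Phi] is chosen before [eps], so one bijection serves for all [eps]. *)
have [Phi HPhi] := choice
  (exists_represents hypX cY prod_le prod_le_psi prod_ge psi0 psi_lsc psi_small).
have [Psi HPsi] := choice
  (represents_surj hypX prod_le prod_le_psi prod_ge psi0 psi_lsc psi_small).
have PhiK : cancel Phi Psi.
  move=> z; apply: (represents_inj hypX prod_le prod_le_psi prod_ge psi0 psi_lsc
    psi_small (HPsi _) (HPhi z)).
have PsiK : cancel Psi Phi.
  by move=> p; exact: (represents_uniq hypX (HPhi _) (HPsi p)).
exists Phi; split; first by exists Psi.
move=> eps eps0 eps_le.
(* This follows from [ln 2 <= 1] and [delta_phi >= 1 / alpha]. *)
have eps_alpha : eps <= alpha.
  apply: (le_trans eps_le).
  have dp : alpha^-1 <= delta_phi.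
    by rewrite /delta_phi -addrA lerDl addr_ge0 ?mulr_ge0// -mulrA mulr_ge0// divr_ge0.
  have dp0 : 0 < delta_phi by rewrite (lt_le_trans ai0).
  rewrite ler_pdivrMr// (@le_trans _ _ 1)//.
    exact: (@le_ln1Dx R 1 (lt_trans (ltrN10 R) ltr01)).
  by rewrite -(mulfV (lt0r_neq0 alpha0)) ler_pM2l.
pose E := expR (eps * K).
have E0 : 0 < E by exact: expR_gt0.
have EC : E <= expR `|alpha * K|.
  have K0 : 0 <= K by rewrite /K !addr_ge0// ltW.
  by rewrite ler_expR (le_trans _ (ler_norm _))// ler_wpM2r.
pose eta r := expN eps (psi r).
(* Boundary products in [Z] are at least [- K]; [expN_le_addr] excludes the value [-oo]. *)
have BZNy z z' : boundary_prod (z : gromov_boundary dZ z0) z' != -oo%E.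
  apply/eqP => BE.
  have := boundary_prod_ge prod_ge psi_ge0 psi_lsc (HPhi z) (HPhi z') (lexx 0)
    (boundary_prod_ge0 _ _) (psi_ge0 _ (mdist_ge0 _ _)).
  by rewrite BE.
have rhoX_le z z' : expN eps (boundary_prod (Phi z).1 (Phi z').1) <=
    E * expN eps (boundary_prod z z').
  apply: expN_le_addr => //.
  exact: (boundary_prod_le hypX prod_le prod_le_psi prod_ge psi0 psi_lsc psi_small).
have eta_le z z' : eta (mdist (Phi z).2 (Phi z').2) <=
    E * expN eps (boundary_prod z z').
  apply: expN_le_addr => //.
  exact: (boundary_prod_le_psi hypX prod_le prod_le_psi prod_ge psi0 psi_lsc psi_small).
have rhoZ_le z z' : expN eps (boundary_prod z z') <= E *
    (expN eps (boundary_prod (Phi z).1 (Phi z').1) + eta (mdist (Phi z).2 (Phi z').2)).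
  have ge := boundary_prod_ge prod_ge psi_ge0 psi_lsc (HPhi z) (HPhi z').
  have BX0 := boundary_prod_ge0 (Phi z).1 (Phi z').1.
  have ps0 : (0 <= psi (mdist (Phi z).2 (Phi z').2))%E by exact: psi_ge0 (mdist_ge0 _ _).
  set b := boundary_prod (Phi z).1 _ in ge BX0 *.
  set p := psi _ in ge ps0; rewrite /eta -/p.
  (* The smaller of [b] and [p] bounds the product in [Z] from below up to [K], and its exponential
     is one of the two summands. *)
  have [bp|/ltW pb] := leP b p.
    apply: (@le_trans _ _ (E * expN eps b)); last first.
      by rewrite ler_pM2l// lerDl expN_ge0.
    apply: expN_le_addr => //; first by apply/eqP => bE; rewrite bE in BX0.
    apply: lee_real_lt => t tb.
    have [t0|t0] := leP 0 t.
      by apply: ge => //; [exact: ltW|exact: le_trans (ltW tb) bp].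
    by apply: (@le_trans _ _ 0%E); [rewrite lee_fin ltW|exact: ge].
  apply: (@le_trans _ _ (E * expN eps p)); last first.
    by rewrite ler_pM2l// lerDr expN_ge0.
  apply: expN_le_addr => //; first by apply/eqP => bE; rewrite bE in ps0.
  apply: lee_real_lt => t tb.
  have [t0|t0] := leP 0 t.
    by apply: ge => //; [exact: le_trans (ltW tb) pb|exact: ltW].
  by apply: (@le_trans _ _ 0%E); [rewrite lee_fin ltW|exact: ge].
have eta00 : eta 0 = 0 by exact: expN_psi0.
have chain k (y : nat -> Y) : eta (mdist (y 0%N) (y k)) <=
    \sum_(i < k) eta (mdist (y i) (y i.+1)).
  exact: (expN_psi_chain alpha0 phi1 phiC1 growth eps0 eps_alpha).
have upper := visual_dist_upper PhiK PsiK E0 eta00 rhoZ_le.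
have lower := visual_dist_lower E0 chain rhoX_le eta_le.
split.
  apply: (visual_homeomorphism PhiK PsiK E0 eta00 chain rhoX_le eta_le rhoZ_le).
  - move=> e e0; have [M HM] := expN_small eps0 e0.
    have [|e' e'0 He'] := psi_lsc M 0 (lexx 0); first by rewrite -/psi psi0 ltry.
    by exists e' => // r r0 re; apply: HM; apply: He'; rewrite ?add0r.
  - move=> e /psi_small[M HM]; have [e' e'0 He'] := expN_small_inv eps0 M.
    by exists e' => // r r0 re; apply: HM => //; apply: He' => //; exact: psi_ge0.
  - by move=> r; exact: expN_ge0.
  - move=> a; apply/eqP; rewrite eq_le visual_dist_ge0 andbT.
    by rewrite (le_trans (visual_dist_le _ _ _))// (boundary_prodxx hypX) expNy.
move=> z z'; rewrite /comparable_with -/K.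
have C0 : 0 < 2 * expR `|alpha * K| by rewrite mulr_gt0 ?expR_gt0.
have v0 := visual_dist_ge0 eps z z'.
have vX0 := visual_dist_ge0 eps (Phi z).1 (Phi z').1.
have et0 : 0 <= eta (mdist (Phi z).2 (Phi z').2) by exact: expN_ge0.
apply/andP; split; last first.
  apply: (le_trans (lower z z')).
  by rewrite ler_wpM2r// ler_pM2l.
rewrite ler_pdivrMl//; apply: (le_trans (upper z z')).
by apply: ler_wpM2r; [exact: addr_ge0|move: EC E0; lra].
Qed.
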